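(* For all non-negative integers $m$ and $n$, $$\mathrm{PP}(2m,n,n)=\mathrm{SPP}(2m,n,n)\cdot \mathrm{TCPP}(2m,n,n).$$
   Context: A plane partition contained in the $(2m)\times n\times n$ box is an $n\times n$ array $\pi=(\pi_{i,j})_{1\le i,j\le n}$ of integers with $0\le\pi_{i,j}\le 2m$ that is weakly decreasing along rows and along columns. $\mathrm{PP}(2m,n,n)$ is the number of such plane partitions. $\mathrm{SPP}(2m,n,n)$ is the number of those that are symmetric, i.e. $\pi_{i,j}=\pi_{j,i}$ for all $i,j$. $\mathrm{TCPP}(2m,n,n)$ is the number of those that are transpose complementary, i.e. $\pi_{i,j}+\pi_{n+1-j,\,n+1-i}=2m$ for all $i,j$. Equivalently, consider the hexagon with angles $120^\circ$ and side lengths $2m,n,n,2m,n,n$ (the sides of length $2m$ being vertical), and its tilings by unit rhombi with angles $60^\circ$ and $120^\circ$: $\mathrm{PP}(2m,n,n)$ is the number of all such tilings, $\mathrm{SPP}(2m,n,n)$ is the number of those symmetric with respect to the vertical symmetry axis of the hexagon, and $\mathrm{TCPP}(2m,n,n)$ is the number of those symmetric with respect to the horizontal symmetry axis of the hexagon. *)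

(* Defs.v *)
From mathcomp Require Import all_boot all_algebra.

Set Implicit Arguments.
Unset Strict Implicit.
Unset Printing Implicit Defensive.

Section PlanePartitions.

Variables h n : nat.

(* The entries, in {0, ..., h}, are ordinals and are compared as naturals. *)
Implicit Type p : 'M['I_h.+1]_n.

Definition plane_partition p : bool :=
  [forall i : 'I_n, forall j : 'I_n, forall k : 'I_n,
     (j <= k) ==> (p i k <= p i j)]
  && [forall j : 'I_n, forall i : 'I_n, forall k : 'I_n,
     (i <= k) ==> (p k j <= p i j)].

Definition symmetric_pp p : bool :=
  plane_partition p && [forall i : 'I_n, forall j : 'I_n, p i j == p j i].

(* With indices starting at 0, rev_ord i = n - 1 - i is the index written
   n + 1 - i when indices start at 1; the sum is taken in nat. *)
Definition transpose_complementary_pp p : bool :=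
  plane_partition p
  && [forall i : 'I_n, forall j : 'I_n,
     (p i j + p (rev_ord j) (rev_ord i))%N == h].

End PlanePartitions.

(* PP h n, SPP h n, TCPP h n stand for PP(h,n,n), SPP(h,n,n), TCPP(h,n,n). *)
Definition PP (h n : nat) : nat :=
  #|[set p : 'M['I_h.+1]_n | plane_partition p]|.

Definition SPP (h n : nat) : nat :=
  #|[set p : 'M['I_h.+1]_n | symmetric_pp p]|.

Definition TCPP (h n : nat) : nat :=
  #|[set p : 'M['I_h.+1]_n | transpose_complementary_pp p]|.

(* Main.v *)
Require Import Defs.
From mathcomp Require Import all_boot all_order all_fingroup all_algebra.
From mathcomp Require Import zify ring lra.

Set Implicit Arguments.
Unset Strict Implicit.
Unset Printing Implicit Defensive.

(** Complementing the entries and cutting an array along its diagonals turns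
    each half into a pattern of interlacing sequences.  Summing over one diagonal
    at a time, the number of patterns with a given main diagonal [lam] is a
    determinant of central factorials evaluated at the points
    [x_i = lam_i + i], centred on the grid of [N = 2m + n] points:
    all degrees [0, ..., n-1] for a full triangle, only the degrees of one parity
    for the staircase above the antidiagonal of a transpose complementary array.

    By Andreief's identity [PP] and [TCPP] are then Gram determinants on the
    grid; as the grid is symmetric about 0, the Gram matrix of [PP] splits into an
    even and an odd block, and one of them is [2^k TCPP] with [k = n/2].  It
    remains to recognise the other one as [SPP / 2^k].  [SPP] is the sum
    of the determinant over increasing sequences [x].  Summing over every other
    [x_i] and symmetrising in the remaining ones gives a Pfaffian-type sum, which
    depends only on the antisymmetric form
    [sum_(x < y) (p_a(x) p_b(y) - p_b(x) p_a(y))].  By symmetry of the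
    grid this form vanishes when [a] and [b] have the same parity, so the sum is a
    determinant; summation of a polynomial against the sign of [y - x] raises the
    degree by one and exchanges parities, so this determinant is a Gram determinant
    for polynomials which differ from the central factorials by a triangular change
    of basis.  All determinant identities are needed only up to sign, since the
    three numbers are nonnegative. *)

(** * Arrays as pairs of interlacing patterns *)

Section Patterns.
Variables (M : nat) (l : nat -> nat).
Hypotheses (l0 : l 0 = 0) (l_step : forall n, l n.+1 <= (l n).+1).

(** The default [M] is the upper bound of all entries, so an inequality whose larger side lies
    beyond the end of a diagonal holds automatically. *)
Definition extend r (f : {ffun 'I_r -> 'I_M.+1}) (i : nat) : nat :=
  if insub i is Some j then f j else M.

Lemma extend_le r (f : {ffun 'I_r -> 'I_M.+1}) i : extend f i <= M.
Proof. by rewrite /extend; case: insub => [j|] //; rewrite -ltnS. Qed.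

Lemma extend_out r (f : {ffun 'I_r -> 'I_M.+1}) i : r <= i -> extend f i = M.
Proof. by move=> ri; rewrite /extend insubN // -leqNgt. Qed.

Lemma extend_ord r (f : {ffun 'I_r -> 'I_M.+1}) (i : 'I_r) : extend f i = f i.
Proof. by rewrite /extend valK. Qed.

(* A pattern of height [n] lists [n] diagonals, of lengths
   [l n.-1], ..., [l 0]; diagonals are continued by the value [M]. *)
Fixpoint pattern n : finType :=
  if n is n'.+1 then ({ffun 'I_(l n') -> 'I_M.+1} * pattern n')%type : finType
  else unit : finType.

Fixpoint interlaced n (lam : nat -> nat) : pattern n -> bool :=
  match n return pattern n -> bool with
  | 0 => fun _ => true
  | n'.+1 => fun t => [forall i : 'I_(l n'), lam i <= t.1 i <= lam i.+1]
                      && interlaced (extend t.1) t.2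
  end.

Fixpoint diag n : pattern n -> nat -> nat -> nat :=
  match n return pattern n -> nat -> nat -> nat with
  | 0 => fun _ _ _ => M
  | n'.+1 => fun t c i => if c is c'.+1 then diag t.2 c' i else extend t.1 i
  end.

Fixpoint pattern_of n (F : nat -> nat -> nat) : pattern n :=
  match n return pattern n with
  | 0 => tt
  | n'.+1 => ([ffun i : 'I_(l n') => inord (F 0 i)], pattern_of n' (fun c => F c.+1))
  end.

Lemma eq_pattern_of n F G : (forall c i, F c i = G c i) -> pattern_of n F = pattern_of n G.
Proof.
elim: n F G => [|n IH] F G FG //=; congr (_, _).
  by apply/ffunP => i; rewrite !ffunE FG.
by apply: IH => c i; apply: FG.
Qed.

Lemma diagK n (t : pattern n) : pattern_of n (diag t) = t.
Proof.
elim: n t => [|n IH] /=; first by case.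
move=> [mu t]; congr (_, _); last exact: IH.
by apply/ffunP => i; rewrite !ffunE /= extend_ord inord_val.
Qed.

Lemma diag_le n (t : pattern n) c i : diag t c i <= M.
Proof.
elim: n t c => [|n IH] t [|c] //=.
exact: extend_le.
Qed.

Lemma diag_out n (t : pattern n) c i : l (n - c.+1) <= i -> diag t c i = M.
Proof.
elim: n t c => [|n IH] t [|c] //=; last by rewrite subSS; apply: IH.
by rewrite subSS subn0; apply: extend_out.
Qed.

Lemma pattern_ofK n F : (forall c i, F c i <= M) ->
  (forall c i, l (n - c.+1) <= i -> F c i = M) ->
  forall c i, diag (pattern_of n F) c i = F c i.
Proof.
elim: n F => [|n IH] F FM Fout c i /=; first by rewrite Fout // l0.
case: c => [|c]; last first.
  by apply: (IH (fun c => F c.+1)) => // c' i' H; apply: Fout; rewrite subSS.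
rewrite /extend; case: insubP => [j _ <-|]; first by rewrite ffunE inordK // ltnS.
by rewrite -leqNgt => H; rewrite Fout // subSS subn0.
Qed.

(** The inequalities may be stated at all positions: beyond the end of a diagonal its entry is [M],
    and by [l_step] the next entry of the preceding diagonal is [M] as well. *)
Lemma interlacedP n (lam : nat -> nat) (t : pattern n) :
  (forall i, lam i <= M) -> (forall i, l n <= i -> lam i = M) ->
  reflect (forall c i, (if c is c'.+1 then diag t c' i else lam i) <= diag t c i
             /\ diag t c i <= (if c is c'.+1 then diag t c' i.+1 else lam i.+1))
          (interlaced lam t).
Proof.
elim: n lam t => [|n IH] lam t lamM lam_out /=.
  apply: ReflectT => -[|c] i /=; split=> //.
  by rewrite lam_out ?l0.
case: t => mu t /=.
have := IH (extend mu) t (extend_le mu) (fun i => @extend_out _ mu i).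
case=> H; last first.
  rewrite andbF; apply: ReflectF => K; apply: H => c i; exact: (K c.+1 i).
rewrite andbT; apply: (iffP forallP) => [K|K i]; last first.
  by have /= [] := K 0 i; rewrite extend_ord => -> ->.
move=> [|c] i; last exact: H.
case: (ltnP i (l n)) => il.
  by have /andP [] := K (Ordinal il); rewrite -(extend_ord mu).
rewrite extend_out //; split => //.
by rewrite lam_out //; apply: leq_trans (l_step n) _; rewrite ltnS.
Qed.

Definition npatterns n (lam : nat -> nat) : nat := #|[pred t : pattern n | interlaced lam t]|.

Lemma npatterns0 lam : npatterns 0 lam = 1.
Proof. by rewrite /npatterns -(card_unit); apply: eq_card => t. Qed.

Lemma npatternsS n lam : npatterns n.+1 lam =
  \sum_(mu : {ffun 'I_(l n) -> 'I_M.+1} | [forall i : 'I_(l n), lam i <= mu i <= lam i.+1])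
     npatterns n (extend mu).
Proof.
rewrite /npatterns -sum1_card.
rewrite (eq_bigl (fun t : pattern n.+1 =>
  [forall i : 'I_(l n), lam i <= t.1 i <= lam i.+1] && interlaced (extend t.1) t.2)) //.
rewrite -(pair_big_dep (fun mu : {ffun 'I_(l n) -> 'I_M.+1} =>
    [forall i : 'I_(l n), lam i <= mu i <= lam i.+1])
   (fun mu (t : pattern n) => interlaced (extend mu) t) (fun _ _ => 1)) /=.
by apply: eq_bigr => mu _; rewrite sum1_card.
Qed.

(** The diagonal at distance [c] from the main one has [l (n - c)] cells, numbered by their smaller
    coordinate. Taking [l = id] gives the square, [l = half] the staircase strictly above the
    antidiagonal. *)
Definition in_region n i j := minn i j < l (n - (maxn i j - minn i j)).

Definition incr_array n (F : nat -> nat -> nat) : Prop :=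
  [/\ forall i j, F i j <= M,
      forall i j, F i j <= F i j.+1,
      forall i j, F i j <= F i.+1 j
    & forall i j, ~~ in_region n i j -> F i j = M].

Definition cell n (lam : {ffun 'I_(l n) -> 'I_M.+1}) (t1 t2 : pattern n) i j :=
  if i <= j then @diag n.+1 (lam, t1) (j - i) i else @diag n.+1 (lam, t2) (i - j) j.

Lemma cell_incr n (lam : {ffun 'I_(l n) -> 'I_M.+1}) t1 t2 :
  interlaced (extend lam) t1 -> interlaced (extend lam) t2 ->
  incr_array n (cell lam t1 t2).
Proof.
have P t : interlaced (extend lam) t -> forall c i,
   @diag n.+1 (lam, t) c i <= @diag n.+1 (lam, t) c.+1 i
   /\ @diag n.+1 (lam, t) c.+1 i <= @diag n.+1 (lam, t) c i.+1.
  by move/(interlacedP _ (extend_le lam) (fun i => @extend_out _ lam i)).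
move=> /P {}P1 /P {}P2.
split=> [i j|i j|i j|i j]; rewrite /cell.
- by case: ifP => _; apply: diag_le.
- case: (leqP i j) => ij; first by rewrite (leqW ij) subSn //; case: (P1 (j - i) i).
  case: (leqP i j.+1) => ij'; last first.
    have -> : i - j = (i - j.+1).+1 by lia.
    by case: (P2 (i - j.+1) j).
  have -> : i = j.+1 by lia.
  by rewrite subSnn subnn; have [_] := P2 0 j.
- case: (leqP i j) => ij; last first.
    by rewrite [i < j]ltnNge (ltnW ij) /= subSn ?(ltnW ij) //; case: (P2 (i - j) j).
  case: (leqP i.+1 j) => ij'.
    have -> : j - i = (j - i.+1).+1 by lia.
    by case: (P1 (j - i.+1) i).
  have -> : j = i by lia.
  by rewrite subSnn subnn; have [] := P2 0 i.
- rewrite /in_region -leqNgt /minn /maxn.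
  case: (ltnP i j) => ij H.
    by rewrite (ltnW ij); apply: diag_out; rewrite subSS.
  case: ifP => ij'; apply: diag_out; rewrite subSS //.
  by have E : i = j by [lia]; move: H; rewrite E.
Qed.

Definition diag0 n (F : nat -> nat -> nat) : {ffun 'I_(l n) -> 'I_M.+1} :=
  [ffun i : 'I_(l n) => inord (F i i)].
Definition upper n (F : nat -> nat -> nat) := pattern_of n (fun c i => F i (i + c.+1)).
Definition lower n (F : nat -> nat -> nat) := pattern_of n (fun c i => F (i + c.+1) i).

Lemma diag_upper n F : incr_array n F -> forall c i,
  @diag n.+1 (diag0 n F, upper n F) c i = F i (i + c).
Proof.
case=> FM _ _ Fout; pose G c i := F i (i + c).
have -> : (diag0 n F, upper n F) = pattern_of n.+1 G.
  by congr (_, _); apply/ffunP => i; rewrite !ffunE /G addn0.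
apply: pattern_ofK => [c i|c i H]; first exact: FM.
apply: Fout; rewrite /in_region (minn_idPl (leq_addr _ _)) (maxn_idPr (leq_addr _ _)).
by rewrite addKn -leqNgt; move: H; rewrite subSS.
Qed.

Lemma diag_lower n F : incr_array n F -> forall c i,
  @diag n.+1 (diag0 n F, lower n F) c i = F (i + c) i.
Proof.
case=> FM _ _ Fout; pose G c i := F (i + c) i.
have -> : (diag0 n F, lower n F) = pattern_of n.+1 G.
  by congr (_, _); apply/ffunP => i; rewrite !ffunE /G addn0.
apply: pattern_ofK => [c i|c i H]; first exact: FM.
apply: Fout; rewrite /in_region (minn_idPr (leq_addr _ _)) (maxn_idPl (leq_addr _ _)).
by rewrite addKn -leqNgt; move: H; rewrite subSS.
Qed.

Lemma interlaced_upper n F : incr_array n F -> interlaced (extend (diag0 n F)) (upper n F).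
Proof.
move=> HF; have D := diag_upper HF; case: HF => FM Fr Fd Fout.
apply/(interlacedP _ (extend_le _) (fun i => @extend_out _ _ i)) => c i.
have D1 := D c.+1 i; have D0 := D c i; have D2 := D c i.+1.
rewrite /= in D1; rewrite D1 addnS.
by case: c {D1} D0 D2 => [|c] /= -> ->; split; rewrite ?addSn.
Qed.

Lemma interlaced_lower n F : incr_array n F -> interlaced (extend (diag0 n F)) (lower n F).
Proof.
move=> HF; have D := diag_lower HF; case: HF => FM Fr Fd Fout.
apply/(interlacedP _ (extend_le _) (fun i => @extend_out _ _ i)) => c i.
have D1 := D c.+1 i; have D0 := D c i; have D2 := D c i.+1.
rewrite /= in D1; rewrite D1 addnS.
by case: c {D1} D0 D2 => [|c] /= -> ->; split; rewrite ?addSn.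
Qed.

Lemma cell_of n F : incr_array n F ->
  forall i j, cell (diag0 n F) (upper n F) (lower n F) i j = F i j.
Proof.
move=> HF i j; rewrite /cell diag_upper // diag_lower //.
by case: (leqP i j) => ij; [rewrite subnKC|rewrite subnKC // ltnW].
Qed.

Lemma diag0_cell n lam (t1 t2 : pattern n) : diag0 n (cell lam t1 t2) = lam.
Proof.
apply/ffunP => i; rewrite ffunE /cell leqnn subnn /= extend_ord.
exact: inord_val.
Qed.

Lemma upper_cell n lam (t1 t2 : pattern n) : upper n (cell lam t1 t2) = t1.
Proof.
rewrite -[RHS]diagK; apply: eq_pattern_of => c i.
by rewrite /cell leq_addr addKn.
Qed.

Lemma lower_cell n lam (t1 t2 : pattern n) : lower n (cell lam t1 t2) = t2.
Proof.
rewrite -[RHS]diagK; apply: eq_pattern_of => c i.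
by rewrite /cell addKn leqNgt addnS ltnS leq_addr.
Qed.

Section Count.
Variables (n : nat) (Z : finType) (A : {pred Z}).
Variables (enc : Z -> nat -> nat -> nat) (dec : (nat -> nat -> nat) -> Z).
Hypothesis dec_ext : forall F G, (forall i j, F i j = G i j) -> dec F = dec G.

(** An array amounts to its main diagonal with two independent patterns, one on each side, both
    interlacing with it; a fixed diagonal thus contributes a square. [dec_ext] replaces functional
    extensionality. *)
Lemma card_arrays :
  (forall z, z \in A -> incr_array n (enc z) /\ dec (enc z) = z) ->
  (forall F, incr_array n F -> dec F \in A /\ forall i j, enc (dec F) i j = F i j) ->
  #|A| = \sum_(lam : {ffun 'I_(l n) -> 'I_M.+1}) npatterns n (extend lam) ^ 2.
Proof.
move=> HA HF.
pose B := [pred x : {ffun 'I_(l n) -> 'I_M.+1} * (pattern n * pattern n) |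
  interlaced (extend x.1) x.2.1 && interlaced (extend x.1) x.2.2].
pose f z := (diag0 n (enc z), (upper n (enc z), lower n (enc z))).
pose g (x : {ffun 'I_(l n) -> 'I_M.+1} * (pattern n * pattern n)) :=
  dec (cell x.1 x.2.1 x.2.2).
transitivity #|B|; last first.
  rewrite -sum1_card (eq_bigl (fun x : {ffun 'I_(l n) -> 'I_M.+1} * (pattern n * pattern n) =>
    predT x.1 && (interlaced (extend x.1) x.2.1 && interlaced (extend x.1) x.2.2))) //.
  rewrite -(pair_big_dep predT (fun (lam : {ffun 'I_(l n) -> 'I_M.+1}) (t : pattern n * pattern n) =>
     interlaced (extend lam) t.1 && interlaced (extend lam) t.2) (fun _ _ => 1)) /=.
  apply: eq_bigr => lam _; rewrite -(pair_big (interlaced (extend lam)) (interlaced (extend lam)) (fun _ _ => 1)) /=.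
  by rewrite sum_nat_const sum1_card.
have fB z : z \in A -> f z \in B.
  move=> /HA [Hz _]; rewrite inE /=; apply/andP; split.
    exact: interlaced_upper.
  exact: interlaced_lower.
have gf : {in A, cancel f g}.
  move=> z /HA [Hz dz]; rewrite /g /= -[RHS]dz; apply: dec_ext => i j.
  exact: cell_of.
have gB x : x \in B -> g x \in A /\ f (g x) = x.
  case: x => lam [t1 t2]; rewrite inE /= => /andP [H1 H2].
  have [gA ge] := HF _ (cell_incr H1 H2); split => //.
  rewrite /f /g; congr (_, (_, _)).
  - by rewrite -[RHS](diag0_cell lam t1 t2); apply/ffunP => i; rewrite !ffunE ge.
  - by rewrite -[RHS](upper_cell lam t1 t2); apply: eq_pattern_of.
  - by rewrite -[RHS](lower_cell lam t1 t2); apply: eq_pattern_of.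
have gfB : {in B, cancel g f} by move=> x /gB [].
apply/eqP; rewrite eqn_leq; apply/andP; split;
  [rewrite -(card_in_imset (can_in_inj gf))|rewrite -(card_in_imset (can_in_inj gfB))];
  apply: subset_leq_card; apply/subsetP => y /imsetP [z zA ->].
  exact: fB.
by case: (gB _ zA).
Qed.

(** By symmetry the upper pattern determines the lower one, hence the first power. *)
Lemma card_symmetric_arrays :
  (forall z, z \in A -> [/\ incr_array n (enc z), forall i j, enc z i j = enc z j i
                           & dec (enc z) = z]) ->
  (forall F, incr_array n F -> (forall i j, F i j = F j i) ->
     dec F \in A /\ forall i j, enc (dec F) i j = F i j) ->
  #|A| = \sum_(lam : {ffun 'I_(l n) -> 'I_M.+1}) npatterns n (extend lam).
Proof.
move=> HA HF.
pose B := [pred x : {ffun 'I_(l n) -> 'I_M.+1} * pattern n | interlaced (extend x.1) x.2].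
pose f z := (diag0 n (enc z), upper n (enc z)).
pose g (x : {ffun 'I_(l n) -> 'I_M.+1} * pattern n) := dec (cell x.1 x.2 x.2).
transitivity #|B|; last first.
  rewrite -sum1_card (eq_bigl (fun x : {ffun 'I_(l n) -> 'I_M.+1} * pattern n =>
    predT x.1 && interlaced (extend x.1) x.2)) //.
  rewrite -(pair_big_dep predT (fun (lam : {ffun 'I_(l n) -> 'I_M.+1}) (t : pattern n) =>
     interlaced (extend lam) t) (fun _ _ => 1)) /=.
  by apply: eq_bigr => lam _; rewrite sum1_card.
have fB z : z \in A -> f z \in B.
  by move=> /HA [Hz _ _]; rewrite inE /=; apply: interlaced_upper.
have gf : {in A, cancel f g}.
  move=> z /HA [Hz sz dz]; rewrite /g /= -[RHS]dz; apply: dec_ext => i j.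
  rewrite -[RHS](cell_of Hz); congr (cell _ _ _ _ _).
  by apply: eq_pattern_of => c k.
have gB x : x \in B -> g x \in A /\ f (g x) = x.
  case: x => lam t; rewrite inE /= => H.
  have cs i j : cell lam t t i j = cell lam t t j i.
    by rewrite /cell; case: (ltngtP i j) => // ->.
  have [gA ge] := HF _ (cell_incr H H) cs; split => //.
  rewrite /f /g; congr (_, _).
  - by rewrite -[RHS](diag0_cell lam t t); apply/ffunP => i; rewrite !ffunE ge.
  - by rewrite -[RHS](upper_cell lam t t); apply: eq_pattern_of.
have gfB : {in B, cancel g f} by move=> x /gB [].
apply/eqP; rewrite eqn_leq; apply/andP; split;
  [rewrite -(card_in_imset (can_in_inj gf))|rewrite -(card_in_imset (can_in_inj gfB))];
  apply: subset_leq_card; apply/subsetP => y /imsetP [z zA ->].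
  exact: fB.
by case: (gB _ zA).
Qed.

End Count.
End Patterns.

(** * Plane partitions and symmetric plane partitions, counted by main diagonal *)

Section Counting.
Variables h n : nat.
Implicit Types (p : 'M['I_h.+1]_n) (F : nat -> nat -> nat).

Definition entry p (i j : nat) : nat :=
  if (insub i, insub j) is (Some i', Some j') then p i' j' else 0.

Lemma entry_ord p (i j : 'I_n) : entry p i j = p i j.
Proof. by rewrite /entry !valK. Qed.

Lemma entryE p i j (ii : i < n) (jj : j < n) : entry p i j = p (Ordinal ii) (Ordinal jj).
Proof. exact: (entry_ord p (Ordinal ii) (Ordinal jj)). Qed.

Lemma entry_out p i j : n <= maxn i j -> entry p i j = 0.
Proof.
rewrite /entry leq_max; case: insubP => [i' ii _|_ //]; rewrite leqNgt ii /=.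
by case: insubP => [j' jj _|//]; rewrite leqNgt jj.
Qed.

Lemma entry_le p i j : entry p i j <= h.
Proof. by rewrite /entry; case: insub => [i'|] //; case: insub => [j'|] //; rewrite -ltnS. Qed.

Lemma plane_partitionP p :
  reflect ((forall i j k : 'I_n, j <= k -> p i k <= p i j)
           /\ (forall i j k : 'I_n, i <= k -> p k j <= p i j)) (plane_partition p).
Proof.
apply: (iffP andP) => -[H1 H2]; split.
- by move=> i j k; move/forallP/(_ i)/forallP/(_ j)/forallP/(_ k)/implyP: H1.
- by move=> i j k; move/forallP/(_ j)/forallP/(_ i)/forallP/(_ k)/implyP: H2.
- by apply/forallP => i; apply/forallP => j; apply/forallP => k; apply/implyP; apply: H1.
- by apply/forallP => j; apply/forallP => i; apply/forallP => k; apply/implyP; apply: H2.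
Qed.

Lemma entry_row p i j : plane_partition p -> entry p i j.+1 <= entry p i j.
Proof.
move/plane_partitionP => [H _]; case: (ltnP (maxn i j.+1) n); last first.
  by move=> /(entry_out p) ->.
rewrite gtn_max => /andP [ii jj].
by rewrite (entryE _ ii jj) (entryE _ ii (ltnW jj)); apply: H => /=.
Qed.

Lemma entry_col p i j : plane_partition p -> entry p i.+1 j <= entry p i j.
Proof.
move/plane_partitionP => [_ H]; case: (ltnP (maxn i.+1 j) n); last first.
  by move=> /(entry_out p) ->.
rewrite gtn_max => /andP [ii jj].
by rewrite (entryE _ ii jj) (entryE _ (ltnW ii) jj); apply: H => /=.
Qed.

Lemma incr_array_row M l F i j k : incr_array M l n F -> j <= k -> F i j <= F i k.
Proof. by case=> _ H _ _; apply: (homo_leq leqnn leq_trans (f := F i)). Qed.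

Lemma incr_array_col M l F i j k : incr_array M l n F -> i <= k -> F i j <= F k j.
Proof. by case=> _ _ H _; apply: (homo_leq leqnn leq_trans (f := F^~ j)). Qed.

Lemma in_region_id i j : in_region id n i j = (maxn i j < n).
Proof.
by rewrite /in_region /minn /maxn; case: (ltnP i j) => ij; apply/idP/idP; lia.
Qed.

Lemma in_region_half i j : in_region half n i j = (i + j.+1 < n).
Proof.
by rewrite /in_region /minn /maxn; case: (ltnP i j) => ij; apply/idP/idP; lia.
Qed.

(** Complementing makes rows and columns increase and turns the default entry 0 outside the square
    into the bound [h] that [incr_array] requires. *)
Definition pp_enc p i j := h - entry p i j.
Definition pp_dec F : 'M['I_h.+1]_n := \matrix_(i, j) inord (h - F i j).

Lemma pp_dec_ext F G : (forall i j, F i j = G i j) -> pp_dec F = pp_dec G.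
Proof. by move=> FG; apply/matrixP => i j; rewrite !mxE FG. Qed.

Lemma pp_decE F (i j : 'I_n) : pp_dec F i j = h - F i j :> nat.
Proof. by rewrite mxE inordK // ltnS leq_subr. Qed.

Lemma pp_encP p : plane_partition p ->
  incr_array h id n (pp_enc p) /\ pp_dec (pp_enc p) = p.
Proof.
move=> pp; split.
  split=> i j; rewrite /pp_enc.
  - exact: leq_subr.
  - by rewrite leq_sub2l ?entry_row.
  - by rewrite leq_sub2l ?entry_col.
  - by rewrite in_region_id -leqNgt => /(entry_out p) ->; rewrite subn0.
apply/matrixP => i j; apply: val_inj.
by rewrite /= pp_decE /pp_enc subKn ?entry_le ?entry_ord.
Qed.

Lemma pp_decP F : incr_array h id n F ->
  plane_partition (pp_dec F) /\ forall i j, pp_enc (pp_dec F) i j = F i j.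
Proof.
move=> HF; split.
  apply/plane_partitionP; split=> i j k H; rewrite !pp_decE leq_sub2l //.
    exact: incr_array_row HF H.
  exact: incr_array_col HF H.
case: HF => FM _ _ Fout i j; rewrite /pp_enc.
case: (ltnP (maxn i j) n) => ij; last first.
  by rewrite entry_out // Fout ?subn0 // in_region_id -leqNgt.
move: ij; rewrite gtn_max => /andP [ii jj].
by rewrite (entryE _ ii jj) pp_decE subKn.
Qed.

Lemma PP_patterns : PP h n =
  \sum_(lam : {ffun 'I_n -> 'I_h.+1}) npatterns h id n (extend lam) ^ 2.
Proof.
rewrite /PP; apply: (@card_arrays h id erefl _ n _ _ pp_enc pp_dec pp_dec_ext) => [n'|p|F HF].
- exact: leqnn.
- by rewrite inE => /pp_encP.
- by have [H1 H2] := pp_decP HF; rewrite inE.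
Qed.

Lemma SPP_patterns : SPP h n =
  \sum_(lam : {ffun 'I_n -> 'I_h.+1}) npatterns h id n (extend lam).
Proof.
rewrite /SPP.
apply: (@card_symmetric_arrays h id erefl _ n _ _ pp_enc pp_dec pp_dec_ext) => [n'|p|F HF FS].
- exact: leqnn.
- rewrite inE => /andP [pp /forallP S].
  have [H1 H2] := pp_encP pp; split=> // i j.
  rewrite /pp_enc; congr (_ - _).
  case: (ltnP (maxn i j) n) => ij; last by rewrite !entry_out // maxnC.
  move: ij; rewrite gtn_max => /andP [ii jj].
  rewrite (entryE _ ii jj) (entryE _ jj ii).
  by have /forallP/(_ (Ordinal jj))/eqP -> := S (Ordinal ii).
- have [H1 H2] := pp_decP HF; split=> //; rewrite inE /symmetric_pp H1 /=.
  apply/forallP => i; apply/forallP => j; apply/eqP/val_inj.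
  by rewrite /= !pp_decE FS.
Qed.

End Counting.

(** * Transpose complementary plane partitions as staircase arrays *)

Section TransposeComplementary.
Variables m n : nat.
Implicit Types (p : 'M['I_(2 * m).+1]_n) (F : nat -> nat -> nat).

(* Only the staircase above the antidiagonal is recorded. *)
Definition tc_enc p i j := if i + j.+1 < n then 2 * m - entry p i j else m.
Definition tc_dec F : 'M['I_(2 * m).+1]_n :=
  \matrix_(i, j) inord (if i + j < n then 2 * m - F i j else F (n - j.+1) (n - i.+1)).

Lemma tc_dec_ext F G : (forall i j, F i j = G i j) -> tc_dec F = tc_dec G.
Proof. by move=> FG; apply/matrixP => i j; rewrite !mxE !FG. Qed.

Lemma tc_decE F (i j : 'I_n) : (forall a b, F a b <= m) ->
  tc_dec F i j = (if i + j < n then 2 * m - F i j else F (n - j.+1) (n - i.+1)) :> nat.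
Proof.
move=> FM; rewrite mxE inordK // ltnS; case: ifP => _; first exact: leq_subr.
by apply: leq_trans (FM _ _) _; rewrite leq_pmull.
Qed.

(** A cell of the antidiagonal is its own mirror image, so twice its entry is [2 * m]. *)
Lemma tc_antidiag p (i j : 'I_n) : transpose_complementary_pp p ->
  i + j.+1 = n -> p i j = m :> nat.
Proof.
move=> /andP [_ /forallP /(_ i) /forallP /(_ j) /eqP H] ij.
have E1 : rev_ord j = i.
  by apply/val_inj/eqP; rewrite /= -(eqn_add2r j.+1) subnK ?ltn_ord // ij.
have E2 : rev_ord i = j.
  apply/val_inj/eqP; rewrite /= -(eqn_add2r i.+1) subnK ?ltn_ord //.
  by rewrite addnS addnC -addnS ij.
by move: H; rewrite E1 E2 addnn -mul2n => /eqP; rewrite eqn_pmul2l // => /eqP.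
Qed.

(** Each row decreases to the value [m] on the antidiagonal. Hence the encoded entries are bounded
    by [m] rather than by [2 * m]. *)
Lemma tc_entry_ge p i j : transpose_complementary_pp p -> i + j.+1 < n -> m <= entry p i j.
Proof.
move=> tp ij; have ii : i < n := leq_ltn_trans (leq_addr _ _) ij.
have jj : j < n by apply: leq_ltn_trans ij; rewrite addnS ltnW // ltnS leq_addl.
have kk : n - i.+1 < n by rewrite ltn_subrL /=; apply: leq_ltn_trans ii.
have D : p (Ordinal ii) (Ordinal kk) = m :> nat by apply: tc_antidiag => //=; lia.
rewrite (entryE _ ii jj) -[X in X <= _]D.
have /andP [/plane_partitionP [H _] _] := tp.
by apply: H => /=; lia.
Qed.

Lemma tc_encP p : transpose_complementary_pp p ->
  incr_array m half n (tc_enc p) /\ tc_dec (tc_enc p) = p.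
Proof.
move=> tp; have /andP [pp /forallP tc] := tp.
have encM i j : tc_enc p i j <= m.
  rewrite /tc_enc; case: ifP => // ij.
  by have := tc_entry_ge tp ij; lia.
split.
  split=> // i j.
  - rewrite {2}/tc_enc; case: ifP => // ij; rewrite /tc_enc.
    have -> : i + j.+1 < n by rewrite (ltn_trans _ ij) // ltn_add2l.
    by rewrite leq_sub2l ?entry_row.
  - rewrite {2}/tc_enc; case: ifP => // ij; rewrite /tc_enc.
    have -> : i + j.+1 < n by rewrite (ltn_trans _ ij) // ltn_add2r.
    by rewrite leq_sub2l ?entry_col.
  - by rewrite in_region_half /tc_enc => /negbTE ->.
apply/matrixP => i j; apply: val_inj; rewrite /= tc_decE //.
case: ltnP => ij.
  rewrite /tc_enc; case: ltnP => ij'.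
    by rewrite subKn ?entry_le ?entry_ord.
  have D : p i j = m :> nat.
    by apply: tc_antidiag => //; apply/eqP; rewrite eqn_leq ij' addnS ij.
  by rewrite -[RHS]/(nat_of_ord (p i j)) D; lia.
have /forallP /(_ j) /eqP H := tc i.
have ii := ltn_ord i; have jj := ltn_ord j.
rewrite /tc_enc; have -> : n - j.+1 + (n - i.+1).+1 < n by lia.
by rewrite -[n - j.+1]/(val (rev_ord j)) -[n - i.+1]/(val (rev_ord i)) entry_ord -[X in X - _]H addnK.
Qed.

Lemma tc_decP F : incr_array m half n F ->
  transpose_complementary_pp (tc_dec F) /\ forall i j, tc_enc (tc_dec F) i j = F i j.
Proof.
move=> HF; have [FM _ _ Fout] := HF; split; last first.
  move=> i j; rewrite /tc_enc; case: ltnP => ij; last first.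
    by rewrite Fout // in_region_half -leqNgt.
  have ii : i < n := leq_ltn_trans (leq_addr _ _) ij.
  have jj : j < n by apply: leq_ltn_trans ij; rewrite addnS ltnW // ltnS leq_addl.
  rewrite (entryE _ ii jj) tc_decE //= (leq_ltn_trans _ ij) ?leq_add2l //.
  by rewrite subKn // (leq_trans (FM _ _)) // leq_pmull.
(* The two branches of [tc_dec] are separated by the value [m], which settles comparisons across the
   antidiagonal. *)
have F2 a b c d : F a b <= 2 * m - F c d.
  by have := FM a b; have := FM c d; lia.
apply/andP; split.
  apply/plane_partitionP; split=> i j k H; rewrite !tc_decE //.
    case: (ltnP (i + k) n) => ik; case: (ltnP (i + j) n) => ij //.
    - by rewrite leq_sub2l // (incr_array_row _ HF H).
    - by move: ik ij H; clear; lia.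
    - by apply: (incr_array_col _ HF); apply: leq_sub2l.
  case: (ltnP (k + j) n) => ik; case: (ltnP (i + j) n) => ij //.
  - by rewrite leq_sub2l // (incr_array_col _ HF H).
  - by move: ik ij H; clear; lia.
  - by apply: (incr_array_row _ HF); apply: leq_sub2l.
apply/forallP => i; apply/forallP => j; rewrite !tc_decE //=.
have ii := ltn_ord i; have jj := ltn_ord j.
have E a : a < n -> n - (n - a.+1).+1 = a by lia.
rewrite !E //.
have FM2 a b : F a b <= 2 * m by apply: leq_trans (FM _ _) _; rewrite leq_pmull.
case: (ltngtP (i + j.+1) n) => ij.
- have -> : i + j < n by lia.
  have -> : n - j.+1 + (n - i.+1) < n = false by lia.
  by rewrite subnK.
- have -> : i + j < n = false by lia.
  have -> : n - j.+1 + (n - i.+1) < n by lia.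
  by rewrite subnKC.
- have -> : i + j < n by lia.
  have -> : n - j.+1 + (n - i.+1) < n by lia.
  rewrite !Fout ?in_region_half; lia.
Qed.

Lemma TCPP_patterns : TCPP (2 * m) n =
  \sum_(lam : {ffun 'I_n./2 -> 'I_m.+1}) npatterns m half n (extend lam) ^ 2.
Proof.
rewrite /TCPP; apply: (@card_arrays m half erefl _ n _ _ tc_enc tc_dec tc_dec_ext) => [n'|p|F HF].
- by lia.
- by rewrite inE => /tc_encP.
- by have [H1 H2] := tc_decP HF; rewrite inE.
Qed.

End TransposeComplementary.

Import Order.TTheory GRing.Theory Num.Theory.
Local Open Scope ring_scope.

(** * Sums of determinants *)

Section Determinants.
Variable R : comNzRingType.

Lemma det_sum_rows (T : finType) k (P : 'I_k -> pred T) (G : 'I_k -> T -> 'I_k -> R) :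
  \det (\matrix_(i, j) \sum_(y | P i y) G i y j)
  = \sum_(v : {ffun 'I_k -> T} | [forall i, P i (v i)]) \det (\matrix_(i, j) G i (v i) j).
Proof.
rewrite /determinant exchange_big; apply: eq_bigr => s _.
rewrite -big_distrr /=; congr (_ * _).
under eq_bigr do rewrite mxE.
rewrite bigA_distr_big_dep; apply: eq_big => [v|v _]; first by apply/familyP/forallP.
by apply: eq_bigr => i _; rewrite mxE.
Qed.

(** Multilinearity in the first [k] rows, with the rows [E] left untouched; for odd [n] such a row
    carries the sums over the whole grid. *)
Lemma det_sum_rows_col (T : finType) k e (P : 'I_k -> pred T)
    (G : 'I_k -> T -> 'I_(k + e) -> R) (E : 'M_(e, k + e)) :
  \det (col_mx (\matrix_(i, j) \sum_(y | P i y) G i y j) E)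
  = \sum_(v : {ffun 'I_k -> T} | [forall i, P i (v i)])
      \det (col_mx (\matrix_(i, j) G i (v i) j) E).
Proof.
rewrite /determinant exchange_big; apply: eq_bigr => s _.
rewrite -big_distrr /=; congr (_ * _).
rewrite big_split_ord /=.
under eq_bigr do rewrite col_mxEu mxE.
rewrite bigA_distr_big_dep big_distrl /=; apply: eq_big => [v|v _]; first by apply/familyP/forallP.
rewrite big_split_ord /=; congr (_ * _); apply: eq_bigr => i _.
  by rewrite col_mxEu mxE.
by rewrite !col_mxEd.
Qed.

Lemma rowsub_perm k N n (s : 'S_k) (v : 'I_k -> 'I_N) (X : 'M[R]_(N, n)) :
  rowsub (v \o s) X = perm_mx s *m rowsub v X.
Proof. by rewrite -row_permE; apply/matrixP => i j; rewrite !mxE. Qed.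

Lemma det_col_perm k e (s : 'S_k) (X : 'M[R]_(k, k + e)) (E : 'M_(e, k + e)) :
  \det (col_mx (perm_mx s *m X) E) = (-1) ^+ s * \det (col_mx X E).
Proof.
have -> : col_mx (perm_mx s *m X) E
  = block_mx (perm_mx s) 0 0 1%:M *m col_mx X E.
  by rewrite mul_block_col !mul0mx mul1mx addr0 add0r.
by rewrite det_mulmx det_lblock det1 mulr1 det_perm.
Qed.

(** Expanding [\det (rowsub v Y)] over permutations gives [k!] equal contributions: permuting the
    first [k] rows of the product costs a sign that cancels the one in the expansion. *)
Lemma andreief_col N k e (X : 'M[R]_(N, k + e)) (Y : 'M_(N, k)) (E : 'M_(e, k + e)) :
  \sum_(v : {ffun 'I_k -> 'I_N})
     \det (col_mx (rowsub v X) E) * \det (rowsub v Y)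
  = k`!%:R * \det (col_mx (Y^T *m X) E).
Proof.
transitivity (\sum_(s : 'S_k) \det (col_mx (Y^T *m X) E)); last first.
  by rewrite sumr_const cardT -cardE card_Sn mulr_natl.
under eq_bigr do rewrite mulrC {1}/determinant big_distrl /=.
rewrite exchange_big; apply: eq_bigr => s _ /=.
under eq_bigr do rewrite -mulrA.
rewrite -big_distrr /=.
transitivity ((-1) ^+ s * \det (col_mx (perm_mx s *m (Y^T *m X)) E)); last first.
  by rewrite det_col_perm mulrA -expr2 sqrr_sign mul1r.
congr (_ * _).
have -> : perm_mx s *m (Y^T *m X)
    = \matrix_(i, j) \sum_y (Y y (s i) * X y j).
  rewrite -row_permE; apply/matrixP => i j; rewrite !mxE.
  by apply: eq_bigr => y _; rewrite !mxE.
rewrite (det_sum_rows_col (fun=> xpredT) (fun i y j => Y y (s i) * X y j)).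
apply: eq_big => [v|v _]; first by apply/esym/forallP.
rewrite /determinant big_distrr; apply: eq_bigr => t _ /=.
rewrite mulrCA; congr (_ * _).
rewrite !big_split_ord /= mulrA -big_split /=; congr (_ * _); apply: eq_bigr => i _.
  by rewrite !col_mxEu !mxE.
by rewrite !col_mxEd.
Qed.

Lemma andreief N k (X Y : 'M[R]_(N, k)) :
  \sum_(v : {ffun 'I_k -> 'I_N}) \det (rowsub v X) * \det (rowsub v Y)
  = k`!%:R * \det (Y^T *m X).
Proof.
transitivity (\sum_(s : 'S_k) \det (Y^T *m X)); last first.
  by rewrite sumr_const cardT -cardE card_Sn mulr_natl.
under eq_bigr do rewrite mulrC {1}/determinant big_distrl /=.
rewrite exchange_big; apply: eq_bigr => s _ /=.
under eq_bigr do rewrite -mulrA.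
rewrite -big_distrr /=.
transitivity ((-1) ^+ s * \det (perm_mx s *m (Y^T *m X))); last first.
  by rewrite det_mulmx det_perm mulrA -expr2 sqrr_sign mul1r.
congr (_ * _).
have -> : perm_mx s *m (Y^T *m X)
    = \matrix_(i, j) \sum_y (Y y (s i) * X y j).
  rewrite -row_permE; apply/matrixP => i j; rewrite !mxE.
  by apply: eq_bigr => y _; rewrite !mxE.
rewrite (det_sum_rows (fun=> xpredT) (fun i y j => Y y (s i) * X y j)).
apply: eq_big => [v|v _]; first by apply/esym/forallP.
rewrite /determinant big_distrr; apply: eq_bigr => t _ /=.
rewrite mulrCA; congr (_ * _).
rewrite -big_split /=; apply: eq_bigr => i _.
by rewrite !mxE.
Qed.

Definition incr_strict k N (v : {ffun 'I_k -> 'I_N}) : bool :=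
  [forall i : 'I_k, forall j : 'I_k, (i < j)%N ==> (v i < v j)%N].

Lemma incr_strictP k N (v : {ffun 'I_k -> 'I_N}) :
  reflect (forall i j : 'I_k, (i < j)%N -> (v i < v j)%N) (incr_strict v).
Proof.
apply: (iffP forallP) => [H i j ij|H i].
  by have /forallP/(_ j)/implyP/(_ ij) := H i.
by apply/forallP => j; apply/implyP; apply: H.
Qed.

Lemma sorted_incr k N (v : {ffun 'I_k -> 'I_N}) :
  incr_strict v = sorted ltn [seq val (v i) | i <- enum 'I_k].
Proof.
apply/incr_strictP/idP => [H|].
  rewrite sorted_map.
  have: sorted (relpre val ltn) (enum 'I_k).
    by rewrite -sorted_map val_enum_ord iota_ltn_sorted.
  by apply: sub_sorted => i j /= /H.
move=> S i j ij.
have := S; rewrite (sorted_pairwise ltn_trans) pairwise_map.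
move=> /(pairwiseP i) /(_ i j).
rewrite !inE size_enum_ord !ltn_ord => /(_ isT isT ij) /=.
by rewrite !nth_ord_enum.
Qed.

(** Existence comes from sorting the values; uniqueness holds because a strictly sorted list is
    determined by its elements and [v] is injective. *)
Lemma unique_sort k N (v : {ffun 'I_k -> 'I_N}) : injectiveb v ->
  exists s : 'S_k, forall t : 'S_k,
    incr_strict [ffun i => v (t i)] = (t == s).
Proof.
move=> /injectiveP vi.
have [s Hs] : exists s : 'S_k, incr_strict [ffun i => v (s i)].
  pose t0 := [tuple val (v i) | i < k].
  have sz : size (sort leq t0) == k by rewrite size_sort size_tuple.
  have : perm_eq (Tuple sz) t0 by rewrite /= perm_sort.
  move=> /tuple_permP [s Hs]; exists s.
  rewrite sorted_incr.
  have -> : [seq val ([ffun i => v (s i)] i) | i <- enum 'I_k] = sort leq t0.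
    rewrite -[sort leq t0]/(tval (Tuple sz)) Hs; apply: eq_map => i.
    by rewrite ffunE tnth_mktuple.
  rewrite ltn_sorted_uniq_leq sort_uniq sort_sorted ?andbT; last exact: leq_total.
  rewrite map_inj_uniq ?enum_uniq // => i j /val_inj /vi //.
exists s => t; apply/idP/eqP => [Ht|->] //.
have: [seq val ([ffun i => v (t i)] i) | i <- enum 'I_k] =
      [seq val ([ffun i => v (s i)] i) | i <- enum 'I_k].
  apply: (irr_sorted_eq ltn_trans ltnn); rewrite -?sorted_incr // => x.
  apply/mapP/mapP => -[i _ ->].
    by exists ((s^-1)%g (t i)); rewrite ?mem_enum // !ffunE permKV.
  by exists ((t^-1)%g (s i)); rewrite ?mem_enum // !ffunE permKV.
move=> /eq_in_map E; apply/permP => i; apply: vi; apply: val_inj.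
by have := E i (mem_enum _ i); rewrite !ffunE.
Qed.

(** Injective [v] form orbits of [k!] elements under permutation of the arguments, each with exactly
    one increasing member. *)
Lemma sum_symmetric k N (D : {ffun 'I_k -> 'I_N} -> R) :
  (forall (v : {ffun 'I_k -> 'I_N}) (s : 'S_k), D [ffun i => v (s i)] = D v) ->
  (forall v : {ffun 'I_k -> 'I_N}, ~~ injectiveb v -> D v = 0) ->
  \sum_(v : {ffun 'I_k -> 'I_N}) D v = k`!%:R * \sum_(v : {ffun 'I_k -> 'I_N} | incr_strict v) D v.
Proof.
move=> Dsym Dinj.
transitivity (\sum_(v : {ffun 'I_k -> 'I_N}) \sum_(s : 'S_k | incr_strict [ffun i => v (s i)]) D v).
  apply: eq_bigr => v _; case: (boolP (injectiveb v)) => [vi|/Dinj ->]; last first.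
    by rewrite big1.
  by have [s Hs] := unique_sort vi; rewrite (eq_bigl _ _ Hs) big_pred1_eq.
rewrite (exchange_big_dep predT) //=.
transitivity (\sum_(s : 'S_k) \sum_(v : {ffun 'I_k -> 'I_N} | incr_strict v) D v).
  apply: eq_bigr => s _.
  rewrite (reindex_onto (fun v : {ffun 'I_k -> 'I_N} => [ffun i => v ((s^-1)%g i)])
                        (fun v : {ffun 'I_k -> 'I_N} => [ffun i => v (s i)])) /=; last first.
    by move=> v _; apply/ffunP => i; rewrite !ffunE permKV.
  apply: eq_big => [v|v _]; last exact: Dsym.
  have -> : [ffun i => [ffun i0 => v ((s^-1)%g i0)] (s i)] = v.
    by apply/ffunP => i; rewrite !ffunE permK.
  by rewrite eqxx andbT.
by rewrite sumr_const cardT -cardE card_Sn mulr_natl.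
Qed.

End Determinants.

(** * Pfaffian-type sums and their dependence on an antisymmetric form *)

Section Pfaffian.
Variables k e : nat.
Local Notation n := ((k + e) + k)%N.
Implicit Types (B : 'I_k -> 'M[rat]_n).

Let rU (i : 'I_k) : 'I_n := lshift k (lshift e i).
Let rE (i : 'I_e) : 'I_n := lshift k (rshift k i).
Let rV (i : 'I_k) : 'I_n := rshift (k + e) i.

(** A determinant expansion in which the rows [rU i] and [rV i] are contracted to a bilinear form
    [B i]. For constant [B] and [e = 0] it is, up to sign, [k!] times the Pfaffian of [B - B^T]. The
    forms may vary with [i] so that they can be exchanged one at a time. *)
Definition pf_sum B (E : 'M[rat]_(e, n)) : rat :=
  \sum_(s : 'S_n) (-1) ^+ s * (\prod_i B i (s (rU i)) (s (rV i))
                               * \prod_l E l (s (rE l))).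

(** Composing [s] with the transposition of [rU i0] and [rV i0] changes the sign and swaps the
    arguments of [B i0]. *)
Lemma pf_sum_tr B E i0 :
  pf_sum B E = - pf_sum (fun i => if i == i0 then (B i)^T else B i) E.
Proof.
rewrite /pf_sum (reindex_inj (mulgI (tperm (rU i0) (rV i0)))) -sumrN /=.
apply: eq_bigr => s _.
rewrite odd_mul_tperm.
have -> : rU i0 != rV i0 by rewrite eq_lrshift.
rewrite /= signrN mulNr; congr (- (_ * _)); congr (_ * _); apply: eq_bigr => i _.
  rewrite !permM; case: eqP => [->|/eqP ni]; first by rewrite tpermL tpermR mxE.
  by rewrite !tpermD // ?eq_lshift ?eq_rshift ?eq_lrshift ?eq_rlshift // eq_sym.
by rewrite permM tpermD // eq_sym ?eq_lshift ?eq_lrshift ?eq_rlshift.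
Qed.

(** Averaging with the expression of [pf_sum_tr] leaves only the antisymmetric part of [B i0]. *)
Lemma pf_sum_slot B B' E i0 :
  B i0 - (B i0)^T = B' i0 - (B' i0)^T -> (forall i, i != i0 -> B i = B' i) ->
  pf_sum B E = pf_sum B' E.
Proof.
have two C : pf_sum C E + pf_sum C E = \sum_(s : 'S_n) (-1) ^+ s *
   ((C i0 - (C i0)^T) (s (rU i0)) (s (rV i0)) *
    \prod_(i | i != i0) C i (s (rU i)) (s (rV i)) * \prod_l E l (s (rE l))).
  rewrite {2}(pf_sum_tr C E i0) /pf_sum -sumrB; apply: eq_bigr => s _.
  rewrite !(bigD1 i0 (P := predT)) //= eqxx !mxE.
  under [X in _ - _ * (_ * X * _)]eq_bigr => i /negbTE ni do rewrite ni.
  by rewrite !mulrBl mulrBr.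
move=> H0 H1.
have E2 : pf_sum B E + pf_sum B E = pf_sum B' E + pf_sum B' E.
  rewrite !two H0; apply: eq_bigr => s _; do 3!congr (_ * _).
  by apply: eq_bigr => i /H1 ->.
lra.
Qed.

Lemma pf_sum_antisym (B B' : 'M[rat]_n) E : B - B^T = B' - B'^T ->
  pf_sum (fun=> B) E = pf_sum (fun=> B') E.
Proof.
move=> H; pose h t (i : 'I_k) := if (i < t)%N then B' else B.
have hh t : (t <= k)%N -> pf_sum (fun=> B) E = pf_sum (h t) E.
  elim: t => [|t IH] tk; first by [].
  rewrite IH ?(ltnW tk) //; apply: (@pf_sum_slot _ _ _ (Ordinal tk)).
    by rewrite /h /= ltnn ltnSn.
  move=> i; rewrite -val_eqE /= /h ltnS => it.
  by rewrite [(i <= t)%N]leq_eqVlt (negbTE it).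
rewrite (hh k) //; apply: eq_bigr => s _; congr (_ * (_ * _)).
by apply: eq_bigr => i _; rewrite /h ltn_ord.
Qed.

(** After expansion, [v i] occurs only in the rows [rU i] and [rV i], so summing over it yields an
    entry of [Q^T *m P]. *)
Lemma pf_sum_det N (Q P : 'M[rat]_(N, n)) (E : 'M_(e, n)) :
  \sum_(v : {ffun 'I_k -> 'I_N})
     \det (col_mx (col_mx (rowsub v Q) E) (rowsub v P))
  = pf_sum (fun=> Q^T *m P) E.
Proof.
rewrite /determinant exchange_big; apply: eq_bigr => s _.
rewrite -big_distrr /=; congr (_ * _).
under [X in _ = X * _]eq_bigr do rewrite mxE.
rewrite bigA_distr_bigA big_distrl; apply: eq_bigr => v _ /=.
rewrite !big_split_ord /= -mulrA [X in _ * X]mulrC mulrA -big_split /=.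
congr (_ * _); apply: eq_bigr => i _; rewrite ?col_mxEu ?col_mxEd ?mxE //.
Qed.

(* A Pfaffian-type sum depends on the rows only through an antisymmetric form,
   so the rows may be replaced by those of a block-diagonal matrix. *)
Lemma sum_det_pairs N (Q P : 'M[rat]_(N, n)) (E' : 'M_(e, k + e)) (A : 'M_(k + e, k)) :
  Q^T *m P - P^T *m Q = block_mx 0 A (- A^T) 0 ->
  \sum_(v : {ffun 'I_k -> 'I_N})
     \det (col_mx (col_mx (rowsub v Q) (row_mx E' 0)) (rowsub v P))
  = k`!%:R * \det (col_mx A^T E').
Proof.
move=> H; rewrite pf_sum_det.
(* These rows have the prescribed antisymmetric form and make every determinant block diagonal. *)
pose Q' : 'M[rat]_(k, n) := row_mx A^T 0.
pose P' : 'M[rat]_(k, n) := row_mx 0 1%:M.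
have EB : Q'^T *m P' = block_mx 0 A 0 0.
  by rewrite tr_row_mx trmxK trmx0 mul_col_row !mulmx0 mul0mx mulmx1.
rewrite (@pf_sum_antisym _ (Q'^T *m P')); last first.
  rewrite trmx_mul trmxK H EB tr_block_mx !trmx0 opp_block_mx add_block_mx.
  by rewrite !oppr0 !addr0 add0r.
(* The identity matrix serves as [Y] in [andreief_col]. *)
have -> : col_mx A^T E' = col_mx ((1%:M)^T *m A^T) E' by rewrite trmx1 mul1mx.
rewrite -pf_sum_det.
rewrite -andreief_col; apply: eq_bigr => v _.
rewrite -(det_lblock (col_mx (rowsub v A^T) E') 0 (rowsub v 1%:M)); congr (\det _).
have -> : rowsub v Q' = row_mx (rowsub v A^T) 0.
  by apply/matrixP => i j; rewrite !mxE; case: split => l; rewrite !mxE.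
have -> : rowsub v P' = row_mx 0 (rowsub v 1%:M).
  by apply/matrixP => i j; rewrite !mxE; case: split => l; rewrite !mxE.
by rewrite -[in RHS](col_mx0 _ k e k) /block_mx -block_mxEh.
Qed.

End Pfaffian.

(** * Determinants of row differences *)

Section Differences.
Variable R : comNzRingType.

(* Left multiplication by a bidiagonal matrix performs the row differences. *)
Lemma det_backward_diff r (K : nat -> nat -> R) :
  (forall j, K r j = 0) ->
  \det (\matrix_(i < r, j < r) (K i j - K i.+1 j)) = \det (\matrix_(i < r, j < r) K i j).
Proof.
move=> K0.
pose L : 'M[R]_r := \matrix_(i, l) ((l == i)%:R - (l == i.+1 :> nat)%:R).
have -> : \matrix_(i < r, j < r) (K i j - K i.+1 j) = L *m \matrix_(i < r, j < r) K i j.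
  apply/matrixP => i j; rewrite !mxE.
  under eq_bigr do rewrite !mxE mulrBl.
  rewrite sumrB (bigD1 i) //= eqxx mul1r big1 ?addr0 => [|l /negbTE ->]; last exact: mul0r.
  congr (_ - _).
  have := ltn_ord i; rewrite leq_eqVlt => /orP [/eqP ir|ir].
    rewrite ir K0 big1 // => l _.
    by rewrite (ltn_eqF (ltn_ord l)) mul0r.
  rewrite (bigD1 (Ordinal ir)) //= eqxx mul1r big1 ?addr0 // => l.
  by rewrite -val_eqE /= => /negbTE ->; rewrite mul0r.
rewrite det_mulmx -det_tr det_trig.
  rewrite big1 ?mul1r // => i _; rewrite !mxE eqxx ltn_eqF ?subr0 //.
apply/is_trig_mxP => i j ij; rewrite !mxE -val_eqE /= !ltn_eqF ?subr0 //.
exact: ltnW.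
Qed.

(** Row differences turn the constant first column into a unit vector; the complementary block, one
    size smaller, holds the differences. *)
Lemma det_forward_diff r (K : nat -> nat -> R) :
  (forall i, K i 0%N = 1) ->
  \det (\matrix_(i < r, j < r) (K i.+1 j.+1 - K i j.+1))
  = \det (\matrix_(i < r.+1, j < r.+1) K i j).
Proof.
move=> K1.
pose L : 'M[R]_r.+1 := \matrix_(i, l) ((l == i)%:R - (l.+1 == i :> nat)%:R).
have dL : \det L = 1.
  rewrite det_trig; last first.
    apply/is_trig_mxP => i j ij; rewrite !mxE -val_eqE /= !gtn_eqF ?subr0 //.
    exact: ltnW.
  by rewrite big1 // => i _; rewrite !mxE eqxx gtn_eqF ?subr0.
rewrite -[RHS]mul1r -dL -det_mulmx.
have -> : L *m \matrix_(i < r.+1, j < r.+1) K i j =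
  @block_mx _ 1 r 1 r 1%:M (\row_j K 0%N j.+1) 0 (\matrix_(i < r, j < r) (K i.+1 j.+1 - K i j.+1)).
  apply/(@matrixP _ (1 + r) (1 + r)) => i j; rewrite mxE.
  under eq_bigr do rewrite !mxE mulrBl.
  rewrite sumrB (bigD1 i) //= eqxx mul1r [X in _ + X - _]big1 ?addr0 => [|l /negbTE ->];
    last exact: mul0r.
  rewrite -[i]splitK -[j]splitK.
  case: (split i) => i'; case: (split j) => j' /=; rewrite ?block_mxEul ?block_mxEur ?block_mxEdl ?block_mxEdr ?(ord1 i') ?(ord1 j') !mxE /=.
  - by rewrite K1 big1 ?subr0 // => l _; rewrite mul0r.
  - by rewrite big1 ?subr0 // => l _; rewrite mul0r.
  - rewrite (bigD1 (widen_ord (leqnSn r) i')) //= add1n eqxx mul1r !K1 big1 ?addr0 ?subrr // => l.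
    by rewrite -val_eqE /= eqSS => /negbTE ->; rewrite mul0r.
  - rewrite (bigD1 (widen_ord (leqnSn r) i')) //= !add1n eqxx mul1r big1 ?addr0 // => l.
    by rewrite -val_eqE /= eqSS => /negbTE ->; rewrite mul0r.
by rewrite (@det_ublock _ 1 r) det1 mul1r.
Qed.

Lemma det_conj_perm n (s : 'S_n) (A : 'M[R]_n) :
  \det (\matrix_(i, j) A (s i) (s j)) = \det A.
Proof.
have -> : \matrix_(i, j) A (s i) (s j) = row_perm s (col_perm s A).
  by apply/matrixP => i j; rewrite !mxE.
rewrite row_permE col_permE !det_mulmx !det_perm odd_permV mulrCA -expr2 sqrr_sign.
by rewrite mulr1.
Qed.

End Differences.

(** * Central factorials *)

(* Central factorials, divided by [d!]: the zeros of [cfact d] are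
   [d] points at distance 1, placed symmetrically about 0. *)
Definition cfact d : {poly rat} :=
  (d`!%:R)^-1 *: \prod_(s < d) ('X - (s%:R - (d%:R - 1) / 2%:R)%:P).

Lemma cfactE d z :
  (cfact d).[z] = (d`!%:R)^-1 * \prod_(s < d) (z + (d%:R - 1) / 2%:R - s%:R).
Proof.
rewrite /cfact hornerZ horner_prod; congr (_ * _); apply: eq_bigr => s _.
rewrite !hornerE; ring.
Qed.

Lemma cfact0 z : (cfact 0).[z] = 1.
Proof. by rewrite cfactE big_ord0 fact0 invr1 mulr1. Qed.

Lemma cfact_opp d z : (cfact d).[- z] = (-1) ^+ d * (cfact d).[z].
Proof.
rewrite !cfactE mulrCA; congr (_ * _).
rewrite [X in _ = _ * X](reindex_inj rev_ord_inj) /=.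
rewrite -[in (-1) ^+ d](card_ord d) -prodrN; apply: eq_bigr => s _ /=.
rewrite natrB; last exact: ltn_ord.
rewrite -[s.+1%:R]natr1; by field.
Qed.

(** The two shifted products share the [d] linear factors of [cfact d]; the two remaining factors
    differ by [d.+1], which the factorials absorb. *)
Lemma cfact_diff d z :
  (cfact d.+1).[z + 2%:R^-1] - (cfact d.+1).[z - 2%:R^-1] = (cfact d).[z].
Proof.
rewrite !cfactE big_ord_recl [X in _ - _ * X]big_ord_recr /=.
have -> : \prod_(i < d) (z + 2%:R^-1 + (d.+1%:R - 1) / 2%:R - (bump 0 i)%:R)
   = \prod_(s < d) (z + (d%:R - 1) / 2%:R - s%:R) :> rat.
  apply: eq_bigr => i _; rewrite /bump /= add1n -!natr1; by field.
have -> : \prod_(i < d) (z - 2%:R^-1 + (d.+1%:R - 1) / 2%:R - i%:R)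
   = \prod_(s < d) (z + (d%:R - 1) / 2%:R - s%:R) :> rat.
  apply: eq_bigr => i _; rewrite -!natr1; by field.

rewrite factS natrM invfM -!natr1.
have d0 : d%:R + 1 != 0 :> rat by rewrite natr1 pnatr_eq0.
have f0 : d`!%:R != 0 :> rat by rewrite pnatr_eq0 -lt0n fact_gt0.
by field; rewrite d0 f0.
Qed.

Lemma size_cfact d : size (cfact d) = d.+1.
Proof.
rewrite size_scale ?invr_eq0 ?pnatr_eq0 -?lt0n ?fact_gt0 //.
by rewrite size_prod_XsubC /index_enum -enumT size_enum_ord.
Qed.

Lemma coef_cfact d : (cfact d)`_d = (d`!%:R)^-1.
Proof.
have <- : lead_coef (cfact d) = (cfact d)`_d by rewrite lead_coefE size_cfact.
by rewrite lead_coefZ (monicP (monic_prod_XsubC _ _ _)) mulr1.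
Qed.

(* With [L = N/2], at a grid point [y] and for [d > 0] this is half the sum of
   [cfact d.-1] over the grid, weighted by the sign of [y - x] (see [skewE]). *)
Definition cmean (L : rat) d : {poly rat} :=
  2%:R^-1 *: ((cfact d \Po ('X + 2%:R^-1%:P)) + (cfact d \Po ('X - 2%:R^-1%:P)))
  - (if d == 0%N then 0 else ((cfact d).[L] + (cfact d).[- L]) / 2%:R)%:P.

Lemma cmeanE L d z : (cmean L d).[z] =
  ((cfact d).[z + 2%:R^-1] + (cfact d).[z - 2%:R^-1]) / 2%:R
  - (if d == 0%N then 0 else ((cfact d).[L] + (cfact d).[- L]) / 2%:R).
Proof.
by rewrite /cmean; move: (cfact d) => c; rewrite !(horner_comp, hornerE) mulrC.
Qed.

(** The convention in degree 0 keeps the constant 1, which supplies the row of plain sums over the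
    grid when [n] is odd. *)
Lemma cmean0 L z : (cmean L 0).[z] = 1.
Proof. by rewrite cmeanE !cfact0 subr0 divff. Qed.

Lemma cmean_opp L d z : (cmean L d).[- z] = (-1) ^+ d * (cmean L d).[z].
Proof.
rewrite !cmeanE mulrBr; congr (_ - _).
  have -> : - z + 2%:R^-1 = - (z - 2%:R^-1) by ring.
  have -> : - z - 2%:R^-1 = - (z + 2%:R^-1) by ring.
  by rewrite !cfact_opp -mulrDr mulrA addrC.
case: eqP => [_|_]; first by rewrite mulr0.
rewrite cfact_opp -signr_odd; case: odd; rewrite ?expr1 ?expr0; ring.
Qed.

Lemma size_cfact_shift d (a : rat) : size (cfact d \Po ('X + a%:P)) = d.+1.
Proof. by rewrite size_comp_poly2 ?size_cfact // size_XaddC. Qed.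

Lemma coef_cfact_shift d (a : rat) : (cfact d \Po ('X + a%:P))`_d = (d`!%:R)^-1.
Proof.
have <- : lead_coef (cfact d \Po ('X + a%:P)) = (cfact d \Po ('X + a%:P))`_d.
  by rewrite lead_coefE size_cfact_shift.
rewrite lead_coef_comp ?size_XaddC // lead_coefXaddC expr1n mulr1.
by rewrite lead_coefE size_cfact coef_cfact.
Qed.

Lemma size_cmean L d : (size (cmean L d) <= d.+1)%N.
Proof.
rewrite /cmean -!polyCN; apply: leq_trans (size_polyD _ _) _; rewrite geq_max.
rewrite (leq_trans (size_scale_leq _ _)) ?(leq_trans (size_polyC_leq1 _)) //.
apply: leq_trans (size_polyD _ _) _.
by rewrite !size_cfact_shift maxnn.
Qed.

Lemma coef_cmean L d : (cmean L d)`_d = (d`!%:R)^-1.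
Proof.
rewrite /cmean coefB coefZ coefD -!polyCN !coef_cfact_shift coefC.
case: eqP => _; rewrite subr0; field; by rewrite pnatr_eq0 -lt0n fact_gt0.
Qed.

(* Both families are triangular with the same diagonal in the monomial basis. *)
Lemma det_pairing_triangular n (T : finType) (z : T -> rat) (p q : nat -> {poly rat})
    (r : T -> nat -> rat) :
  (forall i, (size (p i) <= i.+1)%N) -> (forall i, (size (q i) <= i.+1)%N) ->
  (forall i, (p i)`_i = (q i)`_i) ->
  \det (\matrix_(i < n, j < n) \sum_x (p i).[z x] * r x j)
  = \det (\matrix_(i < n, j < n) \sum_x (q i).[z x] * r x j).
Proof.
move=> sp sq pq.
pose M := \matrix_(l < n, j < n) \sum_x z x ^+ l * r x j.
have key (u : nat -> {poly rat}) : (forall i, (size (u i) <= i.+1)%N) ->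
   \det (\matrix_(i < n, j < n) \sum_x (u i).[z x] * r x j)
   = (\prod_(i < n) (u i)`_i) * \det M.
  move=> su; pose T' := \matrix_(i < n, l < n) (u i)`_l.
  have <- : \det T' = \prod_(i < n) (u i)`_i.
    rewrite det_trig; first by apply: eq_bigr => i _; rewrite mxE.
    apply/is_trig_mxP => i j ij; rewrite mxE nth_default //.
    exact: leq_trans (su i) ij.
  rewrite -det_mulmx; congr (\det _); apply/matrixP => i j; rewrite !mxE.
  under [RHS]eq_bigr do rewrite !mxE big_distrr /=.
  rewrite exchange_big; apply: eq_bigr => x _ /=.
  rewrite (horner_coef_wide _ (leq_trans (su i) (ltn_ord i))) big_distrl.
  by apply: eq_bigr => l _; rewrite mulrA.
by rewrite !key //; congr (_ * _); apply: eq_bigr => i _; rewrite pq.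
Qed.

(** * Determinants counting patterns *)

Lemma sum_ord_interval (V : nmodType) N a b (F : nat -> V) : (b <= N)%N ->
  \sum_(y < N | (a <= y < b)%N) F y = \sum_(a <= i < b) F i.
Proof.
move=> bN; rewrite (big_nat_widenl a 0) // (big_nat_widen 0 b N) // big_mkord.
by apply: eq_bigl => y; rewrite andbC /=.
Qed.

Lemma npatterns_incr M l : l 0%N = 0%N -> (forall n, l n.+1 <= (l n).+1)%N ->
  forall n lam, (forall i, lam i <= M)%N -> (forall i, l n <= i -> lam i = M)%N ->
  npatterns M l n lam != 0%N -> forall i, (lam i <= lam i.+1)%N.
Proof.
move=> l0 ls n lam lM lo; rewrite -lt0n => /card_gt0P [t]; rewrite inE.
by move=> /(interlacedP l0 ls _ lM lo) H i; have [] := H 0%N i; apply: leq_trans.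
Qed.

Lemma extend_incr M r (lam : nat -> nat) (mu : {ffun 'I_r -> 'I_M.+1}) :
  (forall i, lam i <= M)%N ->
  (forall i : 'I_r, lam i <= mu i <= lam i.+1)%N ->
  forall i, (extend mu i <= extend mu i.+1)%N.
Proof.
move=> lM H i; case: (ltnP i.+1 r) => ir; last by rewrite [extend mu i.+1]extend_out ?extend_le.
have /andP [_ H1] := H (Ordinal (ltnW ir)); have /andP [H2 _] := H (Ordinal ir).
by rewrite (extend_ord mu (Ordinal ir)) (extend_ord mu (Ordinal (ltnW ir))) (leq_trans H1).
Qed.

(** The entries of [mu] range over independent intervals, so the sum is taken row by row and
    telescopes. The closed upper end of the interval accounts for [i.+1] beside [lam i.+1]. *)
Lemma sum_interlacing M r (lam : nat -> nat) (f g : nat -> nat -> rat) :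
  (forall i, lam i <= lam i.+1)%N -> (forall i, lam i <= M)%N ->
  (forall x j, f x j = g x.+1 j - g x j) ->
  \sum_(mu : {ffun 'I_r -> 'I_M.+1} | [forall i : 'I_r, (lam i <= mu i <= lam i.+1)%N])
     \det (\matrix_(i < r, j < r) f (mu i + i)%N j)
  = \det (\matrix_(i < r, j < r) (g (lam i.+1 + i.+1)%N j - g (lam i + i)%N j)).
Proof.
move=> linc lM fg.
rewrite -(det_sum_rows (fun (i : 'I_r) (y : 'I_M.+1) => (lam i <= y <= lam i.+1)%N)
  (fun i y j => f (y + i)%N j)).
congr (\det _); apply/matrixP => i j; rewrite !mxE.
rewrite (sum_ord_interval (b := (lam i.+1).+1) _ (fun y => f (y + i)%N j)) ?ltnS //.
under eq_bigr do rewrite fg -addSn.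
rewrite (telescope_sumr (fun y => g (y + i)%N j)) ?addSnnS //.
exact: leq_trans (linc i) _.
Qed.

(** Induction over diagonals: by [cfact_diff] each summation raises the degrees by one, while the
    centre of the grid moves by 1/2; [det_forward_diff] restores the degree 0. *)
Lemma npatterns_det M n lam :
  (forall i, lam i <= lam i.+1)%N -> (forall i, lam i <= M)%N ->
  (npatterns M id n lam)%:R
  = \det (\matrix_(i < n, j < n)
            (cfact j).[(lam i + i)%:R - (M%:R + n%:R - 1) / 2%:R]).
Proof.
elim: n lam => [|n IH] lam linc lM; first by rewrite npatterns0 det_mx00.
rewrite npatternsS natr_sum.
pose a : rat := (M%:R + n.+1%:R - 1) / 2%:R.
transitivity (\det (\matrix_(i < n, j < n)
   ((cfact j.+1).[(lam i.+1 + i.+1)%:R - a] - (cfact j.+1).[(lam i + i)%:R - a]))).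
  rewrite -(@sum_interlacing M n lam
    (fun x j => (cfact j).[x%:R - (M%:R + n%:R - 1) / 2%:R])
    (fun x j => (cfact j.+1).[x%:R - a])) //; last first.
    move=> x j; rewrite -cfact_diff; congr (_.[_] - _.[_]); rewrite /a -!natr1; by field.
  apply: eq_bigr => mu /forallP H; rewrite IH.
  - by congr (\det _); apply/matrixP => i j; rewrite !mxE extend_ord.
  - exact: extend_incr H.
  - exact: extend_le.
rewrite (det_forward_diff n (K := fun i j => (cfact j).[(lam i + i)%:R - a])) //.
by move=> i; rewrite cfact0.
Qed.

(** The same induction, with diagonals that lengthen only at every second step, which leaves the
    degrees of the parity of [n]. The sign [s] stems from differences taken in reverse order and
    disappears on squaring. *)
Lemma npatterns_half_det M n : exists2 s : rat, s ^+ 2 = 1 & forall lam,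
  (forall i, lam i <= lam i.+1)%N -> (forall i, lam i <= M)%N ->
  (forall i, n./2 <= i -> lam i = M)%N ->
  (npatterns M half n lam)%:R
  = s * \det (\matrix_(i < n./2, j < n./2)
            (cfact (j.*2 + odd n)).[M%:R + (n%:R - 1) / 2%:R - (lam i + i)%:R]).
Proof.
elim: n => [|n [s s2 IH]].
  by exists 1 => [|lam _ _ _]; rewrite ?expr1n // npatterns0 det_mx00 mulr1.
pose a : rat := M%:R + (n.+1%:R - 1) / 2%:R.
have key lam : (forall i, lam i <= lam i.+1)%N -> (forall i, lam i <= M)%N ->
  (npatterns M half n.+1 lam)%:R = s * \det (\matrix_(i < n./2, j < n./2)
   ((cfact (j.*2 + odd n).+1).[a - (lam i + i)%:R]
    - (cfact (j.*2 + odd n).+1).[a - (lam i.+1 + i.+1)%:R])).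
  move=> linc lM.
  rewrite npatternsS natr_sum.
  transitivity (s * \det (\matrix_(i < n./2, j < n./2)
     (- (cfact (j.*2 + odd n).+1).[a - (lam i.+1 + i.+1)%:R]
      - - (cfact (j.*2 + odd n).+1).[a - (lam i + i)%:R]))); last first.
    by congr (_ * \det _); apply/matrixP => i j; rewrite !mxE opprK addrC.
  rewrite -(@sum_interlacing M _ lam
    (fun x j => (cfact (j.*2 + odd n)).[M%:R + (n%:R - 1) / 2%:R - x%:R])
    (fun x j => - (cfact (j.*2 + odd n).+1).[a - x%:R])) //; last first.
    move=> x j; rewrite -cfact_diff /= opprK [RHS]addrC.
    by congr (_.[_] - _.[_]); rewrite /a -!natr1; by field.
  rewrite big_distrr /=; apply: eq_bigr => mu /forallP H; rewrite IH.
  - by congr (_ * \det _); apply/matrixP => i j; rewrite !mxE extend_ord.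
  - exact: extend_incr H.
  - exact: extend_le.
  - by move=> i; apply: extend_out.
(* From odd [n] the length grows by one and a column of degree 0 is added. From even [n] the length
   stays and all degrees become odd. *)
case: (boolP (odd n)) => [on|en].
  have E : n.+1./2 = n./2.+1 by lia.
  exists (s * (-1) ^+ n./2) => [|lam linc lM _].
    by rewrite exprMn s2 mul1r sqrr_sign.
  rewrite key // E /= on /= -/a -mulrA.
  rewrite -(det_forward_diff n./2 (K := fun i j => (cfact (j.*2 + 0)).[a - (lam i + i)%:R])).
    rewrite -detZ scaleN1r.
    by congr (_ * \det _); apply/matrixP => i j; rewrite !mxE opprB doubleS addn1 addn0.
  by move=> i; rewrite cfact0.
have E : n.+1./2 = n./2 by lia.
exists s => // lam linc lM lo.
rewrite key // E /= (negbTE en) /=.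
rewrite (det_backward_diff (K := fun i j => (cfact (j.*2 + 0).+1).[a - (lam i + i)%:R])).
  by congr (_ * \det _); apply/matrixP => i j; rewrite !mxE addn0 addn1.
(* Past the end of the diagonal the value [M] puts the argument at the centre 0, where a polynomial
   of odd parity vanishes. *)
move=> j; rewrite lo ?E //.
have -> : a - (M + n./2)%:R = 0.
  rewrite /a natrD -[in n.+1](odd_double_half n) (negbTE en) add0n -natr1 -muln2 natrM; by field.
have := cfact_opp (j.*2 + 0).+1 0.
rewrite oppr0 -signr_odd /= addn0 odd_double expr1 mulN1r => H; lra.
Qed.

(** * Strictly increasing sequences on a grid and Gram determinants *)

Section Strict.
Variables M r : nat.
Implicit Type lam : {ffun 'I_r -> 'I_M.+1}.

Definition incr_weak lam := [forall i : 'I_r, (extend lam i <= extend lam i.+1)%N].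

Lemma incr_weakP lam : reflect (forall i, (extend lam i <= extend lam i.+1)%N) (incr_weak lam).
Proof.
apply: (iffP forallP) => [H i|H i]; last exact: H.
case: (ltnP i r) => ir; first exact: (H (Ordinal ir)).
by rewrite [extend lam i.+1]extend_out ?extend_le // leqW.
Qed.

Lemma shift_lt lam (i : 'I_r) : (lam i + i < M + r)%N.
Proof. by rewrite -addnS leq_add // -ltnS. Qed.

Definition shift lam : {ffun 'I_r -> 'I_(M + r)} := [ffun i => Ordinal (shift_lt lam i)].

Lemma incr_strict_ge N (x : {ffun 'I_r -> 'I_N}) : incr_strict x -> forall i : 'I_r, (i <= x i)%N.
Proof.
move=> /incr_strictP H [i ir] /=; elim: i ir => [|i IH] ir //.
exact: leq_ltn_trans (IH (ltnW ir)) (H (Ordinal (ltnW ir)) (Ordinal ir) (ltnSn i)).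
Qed.

Lemma incr_strict_le (x : {ffun 'I_r -> 'I_(M + r)}) :
  incr_strict x -> forall i : 'I_r, (x i <= M + i)%N.
Proof.
move=> /incr_strictP H; suff K d : forall i : 'I_r, (r - i.+1 = d)%N -> (x i <= M + i)%N.
  by move=> i; apply: K.
elim: d => [|d IH] i ir.
  have := ltn_ord (x i); have := ltn_ord i; move: ir; move: (x i : nat) (i : nat); lia.
have ir' : (i.+1 < r)%N by move: ir; clear; lia.
rewrite -ltnS -addnS; apply: leq_trans (H i (Ordinal ir') (ltnSn i)) (IH (Ordinal ir') _).
by rewrite /= subnS ir.
Qed.

(** Adding the index makes a weakly increasing sequence strict; the bounds [i <= x i <= M + i] make
    this invertible. *)
Lemma sum_strict (V : nmodType) (D : {ffun 'I_r -> 'I_(M + r)} -> V) :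
  \sum_(x | incr_strict x) D x = \sum_(lam | incr_weak lam) D (shift lam).
Proof.
rewrite (reindex_onto shift (fun x : {ffun 'I_r -> 'I_(M + r)} =>
   [ffun i => inord (x i - i)] : {ffun 'I_r -> 'I_M.+1})) /=; last first.
  move=> x sx; apply/ffunP => i; apply: val_inj; rewrite !ffunE /=.
  have xi := incr_strict_ge sx i; have xM := incr_strict_le sx i.
  by rewrite ffunE inordK ?subnK // ltnS leq_subLR [(i + M)%N]addnC.
apply: eq_bigl => lam.
have -> : [ffun i => inord (shift lam i - i)] = lam.
  by apply/ffunP => i; rewrite !ffunE /= addnK inord_val.
rewrite eqxx andbT; apply/incr_strictP/incr_weakP => H.
  move=> i; case: (ltnP i.+1 r) => ir; last by rewrite [extend lam i.+1]extend_out ?extend_le.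
  have := H (Ordinal (ltnW ir)) (Ordinal ir) (ltnSn i).
  rewrite !ffunE /= (extend_ord lam (Ordinal ir)) (extend_ord lam (Ordinal (ltnW ir))).
  by rewrite addnS ltnS leq_add2r.
move=> i j ij; rewrite !ffunE /= -!extend_ord -addnS leq_add //.
have homo := @homo_leq _ (extend lam) leq leqnn leq_trans H.
by apply: homo; apply: ltnW.
Qed.

Variables (s : rat) (K : nat -> nat -> rat) (W : {ffun 'I_r -> 'I_M.+1} -> nat).
Hypotheses (W0 : forall lam, W lam != 0%N -> incr_weak lam)
  (WE : forall lam, incr_weak lam ->
     (W lam)%:R = s * \det (\matrix_(i < r, j < r) K (lam i + i)%N j)).

Let C : 'M[rat]_(M + r, r) := \matrix_(x, j) K x j.

Lemma count_rowsub lam : incr_weak lam -> (W lam)%:R = s * \det (rowsub (shift lam) C).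
Proof.
move=> /WE ->; congr (_ * \det _).
by apply/matrixP => i j; rewrite !mxE ffunE.
Qed.

Lemma sum_count : (\sum_lam W lam)%:R = s * \sum_(x | incr_strict x) \det (rowsub x C).
Proof.
rewrite (bigID incr_weak) /= [X in (_ + X)%N]big1 => [|lam]; last first.
  by apply: contraNeq => /W0.
rewrite addn0 natr_sum sum_strict big_distrr; apply: eq_bigr => lam /=.
exact: count_rowsub.
Qed.

(** This is the Cauchy-Binet formula, obtained from [andreief]: a squared minor is symmetric in its
    rows and vanishes when a row is repeated. *)
Lemma sum_count_sq : s ^+ 2 = 1 -> (\sum_lam W lam ^ 2)%:R = \det (C^T *m C).
Proof.
move=> s2.
have E : (\sum_lam W lam ^ 2)%:R
  = \sum_(x | incr_strict x) \det (rowsub x C) * \det (rowsub x C).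
  rewrite (bigID incr_weak) /= [X in (_ + X)%N]big1 => [|lam]; last first.
    move=> H; have /eqP -> // : W lam == 0%N.
    by apply: contraNT H => /W0.
  rewrite addn0 natr_sum sum_strict; apply: eq_bigr => lam /count_rowsub.
  by rewrite natrX => ->; rewrite exprMn s2 mul1r expr2.
have r0 : r`!%:R != 0 :> rat by rewrite pnatr_eq0 -lt0n fact_gt0.
apply: (mulfI r0); rewrite E -andreief -sum_symmetric // => v.
  move=> t; have -> : rowsub [ffun i => v (t i)] C = perm_mx t *m rowsub v C.
    by rewrite -rowsub_perm; apply/matrixP => i j; rewrite !mxE ffunE.
  by rewrite det_mulmx det_perm mulrACA -expr2 sqrr_sign mul1r.
move=> /injectivePn [i [j ij vij]].
rewrite (determinant_alternate ij) ?mul0r // => l.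
by rewrite !mxE vij.
Qed.

End Strict.

(** * Alternate summation over increasing sequences *)

Section ParitySplit.
Variables (k : nat) (e : bool).
Local Notation n := ((k + e) + k)%N.

(** The same reordering serves the positions of a sequence, split into those summed first and the
    rest, and the degrees, split by parity. *)
Definition even_odd (i : 'I_n) : nat :=
  match split i with inl a => a.*2 | inr b => b.*2.+1 end.

Lemma even_odd_lt i : (even_odd i < n)%N.
Proof.
rewrite /even_odd; case: split => a; have := ltn_ord a; have := leq_b1 e;
  by move: (nat_of_bool e) (nat_of_ord a); clear; lia.
Qed.

Lemma even_odd_inj : injective (fun i => Ordinal (even_odd_lt i)).
Proof.
move=> i j [] E; rewrite -[i]splitK -[j]splitK; congr unsplit.
move: E; rewrite /even_odd; case: (split i) => a; case: (split j) => b E.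
- by congr inl; apply: val_inj; apply: double_inj.
- by have := congr1 odd E; rewrite /= !odd_double.
- by have := congr1 odd E; rewrite /= !odd_double.
- by congr inr; apply: val_inj; apply: double_inj; move: E => [].
Qed.

Definition eo_perm : 'S_n := perm even_odd_inj.

Lemma eo_perml (a : 'I_(k + e)) : eo_perm (lshift k a) = a.*2 :> nat.
Proof. by rewrite permE /= /even_odd (unsplitK (inl a)). Qed.

Lemma eo_permr (b : 'I_k) : eo_perm (rshift (k + e) b) = b.*2.+1 :> nat.
Proof. by rewrite permE /= /even_odd (unsplitK (inr b)). Qed.

Variable N : nat.
Implicit Types (u : {ffun 'I_(k + e) -> 'I_N}) (v : {ffun 'I_k -> 'I_N}).

Definition merge u v : {ffun 'I_n -> 'I_N} :=
  [ffun i => match split ((eo_perm^-1)%g i) with inl a => u a | inr b => v b end].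

Lemma mergel u v a : merge u v (eo_perm (lshift k a)) = u a.
Proof. by rewrite ffunE permK (unsplitK (inl a)). Qed.

Lemma merger u v b : merge u v (eo_perm (rshift (k + e) b)) = v b.
Proof. by rewrite ffunE permK (unsplitK (inr b)). Qed.

(** [lo] and [hi] confine the entry [u i] between consecutive entries of [v]; the default [N] bounds
    the last entry when [e] holds. *)
Definition hi v (i : nat) : nat := if insub i is Some j then val (v j) else N.
Definition lo v (i : nat) : nat := if i is i'.+1 then (hi v i').+1 else 0%N.

Lemma hi_ord v (i : 'I_k) : hi v i = v i.
Proof. by rewrite /hi valK. Qed.

Lemma hi_le v i : (hi v i <= N)%N.
Proof. by rewrite /hi; case: insub => [j|] //; apply: ltnW (ltn_ord _). Qed.

Lemma lo_lt (i : 'I_(k + e)) i' : i = i'.+1 :> nat -> (i' < k)%N.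
Proof. by move=> E; have := ltn_ord i; rewrite E; case: (e); rewrite ?addn1 ?addn0 // => /ltnW. Qed.

Lemma lo_le_hi v (i : 'I_(k + e)) : incr_strict v -> (lo v i <= hi v i)%N.
Proof.
move=> /incr_strictP H; case E: (i : nat) => [|i'] //=.
have ik := lo_lt E; rewrite (hi_ord v (Ordinal ik)).
rewrite /hi; case: insubP => [j _ /= ji|_]; last exact: ltn_ord.
by apply: H; rewrite /= ji.
Qed.

Lemma merge_incr u v : incr_strict (merge u v)
  = incr_strict v && [forall i : 'I_(k + e), (lo v i <= u i < hi v i)%N].
Proof.
apply/incr_strictP/andP => [H|[/incr_strictP Hv /forallP Hu]].
  split.
    apply/incr_strictP => i j ij.
    rewrite -(merger u v i) -(merger u v j); apply: H; rewrite !eo_permr.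
    by rewrite ltnS ltn_double.
  apply/forallP => i; apply/andP; split.
    case E: (i : nat) => [|i'] //=.
    have ik := lo_lt E; rewrite (hi_ord v (Ordinal ik)) -(mergel u v i) -(merger u v (Ordinal ik)).
    by apply: H; rewrite eo_perml eo_permr E doubleS.
  rewrite /hi; case: insubP => [j _ /= ji|_]; last exact: ltn_ord.
  rewrite -(mergel u v i) -(merger u v j).
  by apply: H; rewrite eo_perml eo_permr ji.
have vle (a b : 'I_k) : (a <= b)%N -> (v a <= v b)%N.
  by rewrite leq_eqVlt => /orP [/eqP/val_inj ->|/Hv /ltnW].
have uv (a : 'I_(k + e)) (b : 'I_k) : (a <= b)%N -> (u a < v b)%N.
  move=> ab; have ak : (a < k)%N := leq_ltn_trans ab (ltn_ord b).
  have /andP [_] := Hu a; rewrite (hi_ord v (Ordinal ak)) => /leq_trans; apply.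
  exact: vle.
have vu (a : 'I_k) (b : 'I_(k + e)) : (a < b)%N -> (v a < u b)%N.
  case E: (b : nat) => [|b'] // ab; have bk := lo_lt E.
  have /andP [+ _] := Hu b; rewrite E /= (hi_ord v (Ordinal bk)).
  by apply: leq_ltn_trans; apply: vle.
move=> i j; rewrite -[i](permKV eo_perm) -[j](permKV eo_perm).
move: ((eo_perm^-1)%g i) ((eo_perm^-1)%g j) => {}i {}j.
rewrite -[i]splitK -[j]splitK; case: (split i) => a; case: (split j) => b /=;
  rewrite ?mergel ?merger ?eo_perml ?eo_permr.
- rewrite ltn_double => ab.
  have ak : (a < k)%N by case E: (b : nat) ab => [|b'] //; have := lo_lt E => bk ab; apply: leq_ltn_trans bk.
  exact: ltn_trans (uv a (Ordinal ak) (leqnn _)) (vu (Ordinal ak) b ab).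
- by rewrite ltnS leq_double; apply: uv.
- by move=> ab; apply: vu; rewrite -ltn_double ltnW.
- by rewrite ltnS ltn_double; apply: Hv.
Qed.

Lemma sum_merge (V : nmodType) (D : {ffun 'I_n -> 'I_N} -> V) :
  \sum_(x | incr_strict x) D x
  = \sum_(v : {ffun 'I_k -> 'I_N} | incr_strict v)
      \sum_(u : {ffun 'I_(k + e) -> 'I_N} |
              [forall i : 'I_(k + e), (lo v i <= u i < hi v i)%N]) D (merge u v).
Proof.
rewrite pair_big_dep /=.
rewrite (reindex_onto (fun p : {ffun 'I_k -> 'I_N} * {ffun 'I_(k + e) -> 'I_N} => merge p.2 p.1)
  (fun x : {ffun 'I_n -> 'I_N} => ([ffun b : 'I_k => x (eo_perm (rshift (k + e) b))],
             [ffun a : 'I_(k + e) => x (eo_perm (lshift k a))]))) /=; last first.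
  move=> x _; apply/ffunP => i; rewrite ffunE -[i in RHS](permKV eo_perm).
  rewrite -[X in _ = x (eo_perm X)]splitK.
  by case: split => a; rewrite ffunE.
apply: eq_bigl => -[v u] /=; rewrite merge_incr.
have -> : ([ffun b : 'I_k => merge u v (eo_perm (rshift (k + e) b))],
           [ffun a : 'I_(k + e) => merge u v (eo_perm (lshift k a))]) = (v, u).
  by congr (_, _); apply/ffunP => i; rewrite ffunE ?mergel ?merger.
by rewrite eqxx andbT.
Qed.

Variable f : nat -> nat -> rat.

Definition psum y d := \sum_(0 <= x < y) f x d.

Let P := \matrix_(x < N, j < n) f x (eo_perm j).
Let Q := \matrix_(y < N, j < n) psum y (eo_perm j).
Let T := \matrix_(l < e, j < n) psum N (eo_perm j).

Lemma col_hi v : col_mx (rowsub v Q) T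
  = \matrix_(i < k + e, j < n) psum (hi v i) (eo_perm j).
Proof.
apply/matrixP => i j; rewrite -[i]splitK !mxE; case: (split i) => a.
  by rewrite (unsplitK (inl a)) !mxE /= hi_ord.
by rewrite (unsplitK (inr a)) !mxE /= /hi insubN // -leqNgt leq_addr.
Qed.

(** Row [i] is a difference of partial sums at [hi v i] and [lo v i]. As [lo v i] exceeds the
    preceding entry of [v] by one, the subtracted row is a [Q]-row plus a [P]-row, and a
    unitriangular row operation removes both. *)
Lemma det_row_reduce v : incr_strict v ->
  \det (col_mx (\matrix_(i < k + e, j < n)
                  \sum_(y < N | (lo v i <= y < hi v i)%N) P y j) (rowsub v P))
  = \det (col_mx (col_mx (rowsub v Q) T) (rowsub v P)).
Proof.
move=> sv; rewrite col_hi.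
pose L1 : 'M[rat]_(k + e) := \matrix_(i, l) ((l == i)%:R - (l.+1 == i :> nat)%:R).
pose L2 : 'M[rat]_(k + e, k) := \matrix_(i, l) - (l.+1 == i :> nat)%:R.
have dL : \det L1 = 1.
  rewrite det_trig; last first.
    apply/is_trig_mxP => i j ij; rewrite !mxE -val_eqE /= !gtn_eqF ?subr0 //.
    exact: ltnW.
  by rewrite big1 // => i _; rewrite !mxE eqxx gtn_eqF ?subr0.
rewrite -[RHS]mul1r -dL -[\det L1]mulr1 -(det1 _ k) -(det_ublock L1 L2 1%:M) -det_mulmx.
rewrite mul_block_col mul0mx mul1mx add0r; congr (\det (col_mx _ _)).
apply/matrixP => i j; rewrite !mxE.
transitivity (psum (hi v i) (eo_perm j) - psum (lo v i) (eo_perm j)).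
  under eq_bigr do rewrite mxE.
  rewrite (sum_ord_interval _ (fun y => f y (eo_perm j))) ?hi_le // /psum.
  by rewrite (big_cat_nat (leq0n (lo v i)) (lo_le_hi i sv)) /= addrAC subrr add0r.
under eq_bigr do rewrite !mxE mulrBl.
under [X in _ = _ + X]eq_bigr do rewrite !mxE mulNr.
rewrite sumrB sumrN (bigD1 i) //= eqxx mul1r [X in _ = _ + X - _ - _]big1 => [|l /negbTE ->];
  last exact: mul0r.
rewrite addr0 -addrA -opprD; congr (_ - _).
case E: (i : nat) => [|i'].
  by rewrite /psum /= big_geq // !big1 ?addr0 // => l _; rewrite mul0r.
have ik := lo_lt E; have ik' : (i' < k + e)%N := leq_trans ik (leq_addr _ _).
rewrite (bigD1 (Ordinal ik')) //= eqxx mul1r big1 => [|l]; last first.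
  by rewrite -val_eqE /= eqSS => /negbTE ->; rewrite mul0r.
rewrite (bigD1 (Ordinal ik)) //= eqxx mul1r big1 => [|l]; last first.
  by rewrite -val_eqE /= eqSS => /negbTE ->; rewrite mul0r.
by rewrite !addr0 !(hi_ord v (Ordinal ik)) /psum big_nat_recr.
Qed.

(** Once the even positions are summed, a permutation of [v] acts on the [Q]-rows and the [P]-rows
    at once, so the determinant is symmetric in [v]. The sum therefore extends to all [v], where
    [sum_det_pairs] applies. *)
Lemma sum_incr_det (E' : 'M_(e, k + e)) (A : 'M_(k + e, k)) :
  T = row_mx E' 0 -> Q^T *m P - P^T *m Q = block_mx 0 A (- A^T) 0 ->
  \sum_(x : {ffun 'I_n -> 'I_N} | incr_strict x) \det (\matrix_(i < n, j < n) f (x i) j)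
  = \det (col_mx A^T E').
Proof.
move=> TE QP; rewrite sum_merge.
pose D v := \det (col_mx (col_mx (rowsub v Q) T) (rowsub v P)).
transitivity (\sum_(v : {ffun 'I_k -> 'I_N} | incr_strict v) D v).
  apply: eq_bigr => v sv; rewrite /D -det_row_reduce //.
  rewrite (det_sum_rows_col (fun (i : 'I_(k + e)) (y : 'I_N) => (lo v i <= y < hi v i)%N)
    (fun i y j => P y j)).
  apply: eq_bigr => u _; rewrite -[LHS](det_conj_perm eo_perm); congr (\det _).
  apply/matrixP => i j; rewrite -[i]splitK !mxE.
  case: (split i) => a; rewrite ?(unsplitK (inl a)) ?(unsplitK (inr a)) !mxE /=.
    by rewrite mergel.
  by rewrite merger.
have k0 : k`!%:R != 0 :> rat by rewrite pnatr_eq0 -lt0n fact_gt0.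
apply: (mulfI k0); rewrite -(sum_det_pairs E' QP) -TE -sum_symmetric // => v.
  move=> t; rewrite /D.
  have E X : rowsub [ffun i => v (t i)] X = perm_mx t *m rowsub v X :> 'M[rat]_(k, n).
    by rewrite -rowsub_perm; apply/matrixP => i j; rewrite !mxE ffunE.
  rewrite !E.
  have -> : col_mx (col_mx (perm_mx t *m rowsub v Q) T) (perm_mx t *m rowsub v P)
    = block_mx (block_mx (perm_mx t) 0 0 1%:M) 0 0 (perm_mx t)
      *m col_mx (col_mx (rowsub v Q) T) (rowsub v P).
    by rewrite !mul_block_col !mul0mx mul1mx !addr0 !add0r.
  rewrite det_mulmx !det_lblock det1 mulr1 det_perm -expr2 sqrr_sign.
  by rewrite mul1r.
move=> /injectivePn [i [j ij vij]].
rewrite /D (@determinant_alternate _ _ _ (lshift k (lshift e i)) (lshift k (lshift e j))) //.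
by move=> l; rewrite !col_mxEu !mxE vij.
Qed.

End ParitySplit.

(** * Factorization *)

Section Grid.
Variable N : nat.

Definition grid (x : nat) : rat := x%:R - (N%:R - 1) / 2%:R.

Definition gfact (x d : nat) : rat := (cfact d).[grid x].

Lemma grid_rev (x : 'I_N) : grid (rev_ord x) = - grid x.
Proof. rewrite /grid /= natrB ?ltn_ord // -natr1; by field. Qed.

Lemma sum_grid_odd (F : rat -> rat) : (forall z, F (- z) = - F z) ->
  \sum_(x < N) F (grid x) = 0.
Proof.
move=> Fodd; set S := \sum_(x < N) _.
have : S = - S.
  rewrite {1}/S (reindex_inj rev_ord_inj) /= -sumrN; apply: eq_bigr => x _.
  by rewrite -Fodd -grid_rev.
lra.
Qed.

Lemma psum_grid y d : psum gfact y d =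
  (cfact d.+1).[y%:R - N%:R / 2%:R] - (cfact d.+1).[- (N%:R / 2%:R)].
Proof.
rewrite /psum (telescope_sumr_eq (fun y => (cfact d.+1).[y%:R - N%:R / 2%:R])) //.
  by rewrite sub0r.
move=> x _; rewrite /gfact -cfact_diff.
by congr (_.[_] - _.[_]); rewrite /grid -?natr1; by field.
Qed.

Lemma upper_sum_grid (y : 'I_N) d : \sum_(x < N | (y < x)%N) gfact x d =
  (cfact d.+1).[N%:R / 2%:R] - (cfact d.+1).[y.+1%:R - N%:R / 2%:R].
Proof.
rewrite (eq_bigl (fun x : 'I_N => (y.+1 <= x < N)%N)) => [|x]; last by rewrite ltn_ord andbT.
rewrite (sum_ord_interval _ (fun x => gfact x d)) //.
rewrite (telescope_sumr_eq (fun y => (cfact d.+1).[y%:R - N%:R / 2%:R])) //.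
  by congr (_.[_] - _); by field.
move=> x _; rewrite /gfact -cfact_diff.
by congr (_.[_] - _.[_]); rewrite /grid -?natr1; by field.
Qed.

(** The entries of [Q^T *m P - P^T *m Q], indexed by degrees. *)
Definition skew d d' : rat :=
  \sum_(y < N) (psum gfact y d * gfact y d' - gfact y d * psum gfact y d').

Lemma skewC d d' : skew d d' = - skew d' d.
Proof. rewrite /skew -sumrN; apply: eq_bigr => y _; ring. Qed.

(** Exchanging the summations in the second term pairs [gfact y d'] with the sum of [gfact x d]
    weighted by the sign of [y - x]; telescoping evaluates it as [cmean]. *)
Lemma skewE d d' :
  skew d d' = 2%:R * \sum_(y < N) (cmean (N%:R / 2%:R) d.+1).[grid y] * gfact y d'.
Proof.
rewrite /skew sumrB.
have -> : \sum_(y < N) gfact y d * psum gfact y d' =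
          \sum_(y < N) (\sum_(x < N | (y < x)%N) gfact x d) * gfact y d'.
  transitivity (\sum_(y < N) \sum_(x < N | (x < y)%N) gfact y d * gfact x d').
    apply: eq_bigr => y _; rewrite -big_distrr /=; congr (_ * _).
    rewrite /psum -(sum_ord_interval 0 (fun x => gfact x d') (ltnW (ltn_ord y))).
    by apply: eq_bigl => x.
  rewrite (exchange_big_dep predT) //=; apply: eq_bigr => y _.
  by rewrite big_distrl.
rewrite -sumrB big_distrr; apply: eq_bigr => y _ /=.
rewrite -mulrBl mulrA; congr (_ * _).
rewrite psum_grid upper_sum_grid cmeanE /=.
have -> : grid y + 2%:R^-1 = y.+1%:R - N%:R / 2%:R by rewrite /grid -natr1; by field.
have -> : grid y - 2%:R^-1 = y%:R - N%:R / 2%:R by rewrite /grid; by field.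
by field.
Qed.

Lemma sum_cmean_odd d d' : odd (d + d') ->
  \sum_(y < N) (cmean (N%:R / 2%:R) d).[grid y] * gfact y d' = 0.
Proof.
move=> o; apply: (sum_grid_odd (F := fun z => (cmean (N%:R / 2%:R) d).[z] * (cfact d').[z])).
move=> z; rewrite cmean_opp cfact_opp mulrACA -exprD -signr_odd o expr1; ring.
Qed.

Lemma sum_gfact_odd d d' : odd (d + d') -> \sum_(y < N) gfact y d * gfact y d' = 0.
Proof.
move=> o; apply: (sum_grid_odd (F := fun z => (cfact d).[z] * (cfact d').[z])).
move=> z; rewrite !cfact_opp mulrACA -exprD -signr_odd o expr1; ring.
Qed.

(** The degree raised by one in [skewE] makes the summand an odd function on a symmetric grid. *)
Lemma skew_even d d' : ~~ odd (d + d') -> skew d d' = 0.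
Proof. by move=> o; rewrite skewE sum_cmean_odd ?mulr0. Qed.

Lemma psum_odd d : odd d -> psum gfact N d = 0.
Proof.
move=> o; rewrite -[RHS](@sum_gfact_odd d 0) ?addn0 // /psum big_mkord.
by apply: eq_bigr => y _; rewrite [gfact y 0]cfact0 mulr1.
Qed.

End Grid.

(** Reflection pairs the two halves; the middle point, present when [e] holds, is 0. *)
Lemma sum_grid_half a (e : bool) (F : rat -> rat) : (forall z, F (- z) = F z) ->
  (e -> F 0 = 0) ->
  \sum_(x < a + e + a) F (grid (a + e + a) x)
  = 2%:R * \sum_(x < a) F (grid (a + e + a) x).
Proof.
move=> Fev F0; set N := (a + e + a)%N.
rewrite !big_split_ord /= [X in _ + X + _]big1 => [|i _]; last first.
  have e1 : e by case: (e) i => // -[].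
  rewrite -[RHS]F0 //; congr F; have -> : i = 0%N :> nat by case: i => i /=; rewrite e1; case: i.
  rewrite /grid /N e1 !natrD addr0 /=; by field.
rewrite addr0 mulr2n mulrDl mul1r; congr (_ + _).
rewrite (reindex_inj rev_ord_inj) /=; apply: eq_bigr => x _.
rewrite -Fev; congr F; rewrite /grid /N !natrD natrB ?ltn_ord // -natr1; by field.
Qed.

Lemma det_scale_rows k (c : rat) (t : nat -> rat) (b : nat -> nat -> rat) :
  \det (\matrix_(i < k.+1, j < k.+1) (if i == 0%N :> nat then t j else c * b i.-1 j))
  = c ^+ k * \det (\matrix_(i < k.+1, j < k.+1) (if i == 0%N :> nat then t j else b i.-1 j)).
Proof.
pose D : 'rV[rat]_k.+1 := \row_i (if i == 0%N :> nat then 1 else c).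
have -> : c ^+ k = \det (diag_mx D).
  rewrite det_diag big_ord_recl mxE /= mul1r.
  under eq_bigr do rewrite mxE /=.
  by rewrite prodr_const card_ord.
rewrite -det_mulmx mul_diag_mx; congr (\det _); apply/matrixP => i j; rewrite !mxE.
by case: eqP => _; rewrite ?mul1r.
Qed.

Lemma norm_det_last_row k (t : nat -> rat) (b : nat -> nat -> rat) :
  `|\det (\matrix_(i < k.+1, j < k.+1) (if i == 0%N :> nat then t j else b i.-1 j))|
  = `|\det (\matrix_(i < k.+1, j < k.+1) (if (i < k)%N then b i j else t j))|.
Proof.
pose s : 'S_k.+1 := perm (can_inj (@ordSK k.+1)).
set X := \matrix_(i, j) _; set Y := \matrix_(i, j) _.
have -> : Y = row_perm s X.
  apply/matrixP => i j; rewrite !mxE permE /=.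
  case: ltnP => ik; first by rewrite modn_small.
  have -> : i = k :> nat by apply/eqP; rewrite eqn_leq ik -ltnS ltn_ord.
  by rewrite modnn.
by rewrite row_permE det_mulmx det_perm normrM normrX normrN1 expr1n mul1r.
Qed.

Lemma eq_size_det a b (g : nat -> nat -> rat) : a = b ->
  \det (\matrix_(i < a, j < a) g i j) = \det (\matrix_(i < b, j < b) g i j).
Proof. by move=> ->. Qed.

(** * The three counts as determinants on a common grid *)

Section Assembly.
Variables (m k : nat) (e : bool).
Local Notation n := ((k + e) + k)%N.
Local Notation N := (2 * m + n)%N.
Local Notation g := (gfact N).

Let half_n : n./2 = k.
Proof. by rewrite addnAC addnn; case: (e); rewrite ?addn1 ?addn0 /= ?uphalf_double ?doubleK. Qed.

Let odd_n : odd n = e.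
Proof. by rewrite addnAC addnn oddD odd_double; case: (e). Qed.

Lemma PP_det : (PP (2 * m) n)%:R
  = \det (\matrix_(i < n, j < n) \sum_(x < N) g x i * g x j).
Proof.
rewrite PP_patterns.
rewrite (@sum_count_sq (2 * m) n 1 g (fun lam => npatterns (2 * m) id n (extend lam))).
- by congr (\det _); apply/matrixP => i j; rewrite !mxE; apply: eq_bigr => x _; rewrite !mxE.
- move=> lam H; apply/incr_weakP.
  by apply: (npatterns_incr _ _ (extend_le lam) _ H) => // i; apply: extend_out.
- move=> lam /incr_weakP H; rewrite mul1r npatterns_det //; last exact: extend_le.
  congr (\det _); apply/matrixP => i j; rewrite !mxE extend_ord.
  by rewrite /gfact /grid [(_ + n)%:R]natrD.
- by rewrite expr1n.
Qed.

Lemma SPP_det : (SPP (2 * m) n)%:R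
  = \sum_(x : {ffun 'I_n -> 'I_N} | incr_strict x) \det (\matrix_(i < n, j < n) g (x i) j).
Proof.
rewrite SPP_patterns.
rewrite (@sum_count (2 * m) n 1 g (fun lam => npatterns (2 * m) id n (extend lam))).
- rewrite mul1r; apply: eq_bigr => x _.
  by congr (\det _); apply/matrixP => i j; rewrite !mxE.
- move=> lam H; apply/incr_weakP.
  by apply: (npatterns_incr _ _ (extend_le lam) _ H) => // i; apply: extend_out.
- move=> lam /incr_weakP H; rewrite mul1r npatterns_det //; last exact: extend_le.
  congr (\det _); apply/matrixP => i j; rewrite !mxE extend_ord.
  by rewrite /gfact /grid [(_ + n)%:R]natrD.
Qed.

(** The staircase count lives on [m + k] points, one half of the grid without its centre. Products
    of equal parity are even functions, so passing to the full grid doubles every entry and costs a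
    factor 2 in each of [k] rows. *)
Lemma TCPP_det : 2%:R ^+ k * (TCPP (2 * m) n)%:R
  = \det (\matrix_(i < k, j < k) \sum_(x < N) g x (i.*2 + e) * g x (j.*2 + e)).
Proof.
rewrite TCPP_patterns.
have [s s2 H] := npatterns_half_det m n.
pose K x j : rat := (cfact (j.*2 + e)).[m%:R + (n%:R - 1) / 2%:R - x%:R].
rewrite (@sum_count_sq m n./2 s K (fun lam => npatterns m half n (extend lam))) //; first last.
- move=> lam /incr_weakP Hl; rewrite H //.
  + by congr (_ * \det _); apply/matrixP => i j; rewrite !mxE extend_ord odd_n.
  + exact: extend_le.
  + by move=> i; apply: extend_out.
- move=> lam Hl; apply/incr_weakP.
  apply: (npatterns_incr _ _ (extend_le lam) _ Hl) => // [n'|i]; last exact: extend_out.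
  by lia.
rewrite half_n -detZ; congr (\det _); apply/matrixP => i j; rewrite !mxE.
have -> : N = ((m + k) + e + (m + k))%N by rewrite mul2n -addnn; lia.
rewrite (@sum_grid_half (m + k) e (fun z => (cfact (i.*2 + e)).[z] * (cfact (j.*2 + e)).[z])).
- congr (_ * _); apply: eq_bigr => x _; rewrite !mxE /K.
  have -> : m%:R + (n%:R - 1) / 2%:R - x%:R = - grid (m + k + e + (m + k)) x.
    rewrite /grid !natrD; by field.
  rewrite !cfact_opp mulrACA -exprD -signr_odd !oddD !odd_double /= addbb mul1r.
  by [].
- by move=> z; rewrite !cfact_opp mulrACA -exprD -signr_odd !oddD !odd_double /= addbb mul1r.
- move=> e1; have := cfact_opp (i.*2 + e) 0.
  rewrite oppr0 -signr_odd oddD odd_double e1 /= expr1 mulN1r => H0.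
  have -> : (cfact (i.*2 + 1)).[0] = 0 by lra.
  by rewrite mul0r.
Qed.

Let A : 'M[rat]_(k + e, k) := \matrix_(a, b) skew N a.*2 b.*2.+1.
Let E : 'M[rat]_(e, k + e) := \matrix_(l, b) psum g N b.*2.

(** With even degrees placed first, [skew_even] and [psum_odd] give exactly the zero blocks that
    [sum_incr_det] requires. *)
Lemma SPP_skew : (SPP (2 * m) n)%:R = \det (col_mx A^T E).
Proof.
rewrite SPP_det; apply: sum_incr_det.
  apply/matrixP => l j; rewrite -[j]splitK mxE.
  case: (split j) => b; first by rewrite row_mxEl mxE eo_perml.
  by rewrite row_mxEr mxE eo_permr psum_odd //= odd_double.
apply/matrixP => i j; rewrite -[i]splitK -[j]splitK mxE [X in _ + X]mxE ![in LHS]mxE.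
rewrite -sumrB.
transitivity (skew N (eo_perm k e (unsplit (split i))) (eo_perm k e (unsplit (split j)))).
  by apply: eq_bigr => y _; rewrite !mxE.
case: (split i) => a; case: (split j) => b; rewrite ?eo_perml ?eo_permr.
- by rewrite block_mxEul mxE skew_even // oddD !odd_double.
- by rewrite block_mxEur mxE.
- by rewrite block_mxEdl !mxE skewC.
- by rewrite block_mxEdr mxE skew_even // oddD /= !odd_double.
Qed.

(** Degrees of parity [e] keep [cfact], as in [TCPP_det]; the others take [cmean], so that [skewE]
    links them with the form in [SPP_skew]. *)
Definition adapted d : {poly rat} :=
  if odd d == e then cfact d else cmean (N%:R / 2%:R) d.

Definition pairing d d' : rat := \sum_(x < N) (adapted d).[grid N x] * g x d'.

(** Only one factor of each Gram entry is replaced, which preserves the determinant by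
    triangularity; pairings of opposite parity vanish by reflection. *)
Lemma PP_blocks : (PP (2 * m) n)%:R =
  \det (\matrix_(i < k + e, j < k + e) pairing i.*2 j.*2)
  * \det (\matrix_(i < k, j < k) pairing i.*2.+1 j.*2.+1).
Proof.
rewrite PP_det (@det_pairing_triangular n _ (fun x : 'I_N => grid N x) cfact adapted
  (fun x j => g x j)); first last.
- by move=> i; rewrite /adapted; case: eqP => _; rewrite ?coef_cmean ?coef_cfact.
- by move=> i; rewrite /adapted; case: eqP => _; rewrite ?size_cmean ?size_cfact.
- by move=> i; rewrite size_cfact.
rewrite -(det_conj_perm (eo_perm k e)).
rewrite -(det_ublock _ 0); congr (\det _).
have pairing0 d d' : odd (d + d') -> pairing d d' = 0.
  rewrite /pairing /adapted => o.
  by case: eqP => _; [apply: sum_gfact_odd|apply: sum_cmean_odd].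
apply/matrixP => i j; rewrite -[i]splitK -[j]splitK [LHS]mxE [LHS]mxE.
transitivity (pairing (eo_perm k e (unsplit (split i))) (eo_perm k e (unsplit (split j)))).
  by [].
case: (split i) => a; case: (split j) => b; rewrite ?eo_perml ?eo_permr.
- by rewrite block_mxEul mxE.
- by rewrite block_mxEur mxE pairing0 // addnS /= oddD !odd_double.
- by rewrite block_mxEdl mxE pairing0 // addSn /= oddD !odd_double.
- by rewrite block_mxEdr mxE.
Qed.

Lemma pairing_same d d' : odd d = e -> pairing d d' = \sum_(x < N) g x d * g x d'.
Proof. by move=> o; apply: eq_bigr => x _; rewrite /adapted o eqxx. Qed.

Lemma pairing_skew d d' : odd d = e -> pairing d.+1 d' = 2%:R^-1 * skew N d d'.
Proof.
move=> o; rewrite skewE mulKf // /pairing /adapted /= o.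
by have -> : (~~ e == e) = false by case: (e).
Qed.

End Assembly.

Lemma PP_factor m k (e : bool) :
  PP (2 * m) ((k + e) + k) = (SPP (2 * m) ((k + e) + k) * TCPP (2 * m) ((k + e) + k))%N.
Proof.
apply/eqP; rewrite -(eqr_nat rat) natrM -[_%:R]ger0_norm ?ler0n //.
rewrite -[X in _ == X * _]ger0_norm ?ler0n // -[X in _ == _ * X]ger0_norm ?ler0n //.
have two0 : 2%:R ^+ k != 0 :> rat by rewrite expf_neq0.
have T := TCPP_det m k e.
have {T} -> : (TCPP (2 * m) (k + e + k))%:R = 2%:R ^- k *
  \det (\matrix_(i < k, j < k) \sum_(x < 2 * m + (k + e + k))
     gfact (2 * m + (k + e + k)) x (i.*2 + e) * gfact (2 * m + (k + e + k)) x (j.*2 + e)) :> rat.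
  by rewrite -T mulKf.
rewrite SPP_skew PP_blocks normrM normrM mulrA; apply/eqP.
case: e.
(* For odd [n] the odd block gives [TCPP] and the even block, of size [k + 1], gives [SPP]. *)
- set N := (2 * m + (k + true + k))%N.
  congr (_ * _); last first.
    congr `|\det _|; apply/matrixP => i j; rewrite !mxE pairing_same /= ?odd_double //.
    by apply: eq_bigr => x _; rewrite [(i.*2 + 1)%N]addn1 [(j.*2 + 1)%N]addn1.
  rewrite (eq_size_det (fun i j => pairing m k true i.*2 j.*2) (addn1 k)).
  pose t j := psum (gfact N) N j.*2.
  pose b i j := skew N i.*2.+1 j.*2.
  (* Row 0 comes from [cmean0] and consists of total sums; the other [k] rows carry the factor 1/2
     of [pairing_skew]. *)
  have -> : \det (\matrix_(i < k.+1, j < k.+1) pairing m k true i.*2 j.*2)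
    = 2%:R ^- k * \det (\matrix_(i < k.+1, j < k.+1) (if i == 0%N :> nat then t j else b i.-1 j)).
    rewrite -exprVn -det_scale_rows; congr (\det _); apply/matrixP => i j; rewrite !mxE.
    case: (i : nat) => [|i'] /=; last by rewrite doubleS pairing_skew //= odd_double.
    rewrite /t /psum big_mkord; apply: eq_bigr => x _.
    by rewrite /adapted /= cmean0 mul1r.
  rewrite normrM mulrC; congr (_ * _).
  (* Antisymmetry of [skew] costs a sign in each row of [b]; the row of total sums then moves to the
     bottom, as in [SPP_skew]. *)
  transitivity `|(-1) ^+ k * \det (\matrix_(i < k.+1, j < k.+1)
       (if i == 0%N :> nat then t j else b i.-1 j))|.
    by rewrite normrM normrX normrN1 expr1n mul1r.
  rewrite -det_scale_rows (norm_det_last_row k t (fun i j => -1 * b i j)).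
  rewrite -(eq_size_det (fun i j => if (i < k)%N then -1 * b i j else t j) (addn1 k)).
  congr `|\det _|; apply/matrixP => i j; rewrite -[i]splitK [LHS]mxE.
  case: (split i) => a; rewrite ?col_mxEu ?col_mxEd !mxE /=.
    by rewrite ltn_ord mulN1r /b -skewC.
  by rewrite ltnNge leq_addr.
(* For even [n] the even block gives [TCPP], and the odd block is half the transpose of the matrix
   in [SPP_skew]. *)
- set N := (2 * m + (k + false + k))%N.
  rewrite mulrC; congr (_ * _); last first.
    rewrite (eq_size_det (fun i j => pairing m k false i.*2 j.*2) (addn0 k)).
    congr `|\det _|; apply/matrixP => i j; rewrite !mxE pairing_same /= ?odd_double //.
    by apply: eq_bigr => x _; rewrite [(i.*2 + 0)%N]addn0 [(j.*2 + 0)%N]addn0.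
  have -> : \matrix_(i < k, j < k) pairing m k false i.*2.+1 j.*2.+1
    = 2%:R^-1 *: \matrix_(i < k, j < k) skew N i.*2 j.*2.+1.
    by apply/matrixP => i j; rewrite !mxE pairing_skew //= odd_double.
  rewrite detZ exprVn normrM mulrC; congr (_ * _).
  transitivity `|\det (\matrix_(i < k + 0, j < k + 0) skew N j.*2 i.*2.+1)|.
    rewrite (eq_size_det (fun i j => skew N j.*2 i.*2.+1) (addn0 k)) -det_tr.
    by congr `|\det _|; apply/matrixP => i j; rewrite !mxE.
  congr `|\det _|; apply/matrixP => i j; rewrite -[i]splitK [LHS]mxE.
  by case: (split i) => [a|[]] //; rewrite col_mxEu !mxE.
Qed.

Local Close Scope ring_scope.

Theorem mainTheorem5 (m n : nat) :
  PP (2 * m) n = SPP (2 * m) n * TCPP (2 * m) n.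
Proof.
have -> : n = n./2 + odd n + n./2.
  by rewrite addnAC addnn addnC odd_double_half.
exact: PP_factor.
Qed.
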